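(* Let $\mathcal F=\mathrm{FS}\langle S|R\rangle$ be a presented Ore FS category with FS groups $G^T,G^V$, and let $a\in S$ be a fixed colour. For each coloured tree $t$ over $S$ define $\chi(t)\in\mathbf Z^S$ by letting $\chi(t)(b)$ be the number of $b$-coloured interior vertices of $t$. Then for $Y=T$ and $Y=V$ the map $[t\pi,s]\mapsto\chi(t)-\chi(s)$ induces an isomorphism from the abelianisation $G^Y_{\mathrm{ab}}=G^Y/[G^Y,G^Y]$; thus $$G^T_{\mathrm{ab}}\simeq G^V_{\mathrm{ab}}\simeq\mathbf Z^S/\langle\chi(u)=\chi(v),\ a=0:\ (u,v)\in R\rangle .$$
   Context: $\mathbf Z^S$ denotes the free abelian group on the set $S$ (finitely supported functions), and the quotient above is by the subgroup generated by the basis element $a$ and all $\chi(u)-\chi(v)$, $(u,v)\in R$. FS categories. A tree is a finite rooted planar binary tree in which each vertex has zero children (a leaf) or two children (an interior vertex); leaves are ordered from left to right. $I$ is the one-vertex tree. For a non-empty set $S$ of colours, a coloured tree is a tree with a map from its interior vertices to $S$. A (coloured) forest is a finite list $f=(f_1,\dots,f_n)$ of coloured trees; it has $n$ roots, and its leaves are those of $f_1,\dots,f_n$ in order. If $f$ has as many leaves as $g$ has roots, $f\circ g$ (or $fg$) is obtained by gluing the $i$th tree of $g$ to the $i$th leaf of $f$; $f\otimes g$ is concatenation of lists. This gives a monoidal category $\mathrm{FS}\langle S\rangle$ with object set $\{1,2,3,\dots\}$ (a forest with $r$ roots and $l$ leaves is a morphism $l\to r$). A skein relation is a pair $(u,v)$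 of coloured trees with the same number of leaves. For a set $R$ of skein relations, $\mathrm{FS}\langle S|R\rangle$ is the quotient of $\mathrm{FS}\langle S\rangle$ by the smallest equivalence relation containing $R$ and closed under $\circ$ and $\otimes$; its morphisms are still called forests, and trees if they have one root. It is Ore if it is left-cancellative ($fg=fh\Rightarrow g=h$) and has common right-multiples (if $f,g$ have the same number of roots there are $h,k$ with $fh=gk$). FS groups. Let $\mathcal F$ be an Ore FS category. $\mathcal F^V$ is the category of pairs $(f,\pi)=f\pi$ with $f\in\mathcal F$ having $l$ leaves and $\pi\in\Sigma_l$, with $(f,\sigma)\circ(g,\tau)=(f\circ g^\sigma,\sigma^g\circ\tau)$, where $g^\sigma$ is the forest whose $\sigma(j)$th tree is the $j$th tree of $g$, and $\sigma^g$ maps the block of leaves of the $j$th tree of $g$ order-preservingly onto the block of leaves of the $\sigma(j)$th tree of $g^\sigma$. $\mathcal F^T$ is the subcategory where $\pi$ is cyclic (a power of $(1\,2\cdots l)$). $G^V$ (resp. $G^T$) is the set of classes $[x,y]$ of pairs of one-rooted elements $x,y$ of $\mathcal F^V$ (resp. $\mathcal F^T$) with the same number of leaves, modulo $(x,y)\sim(xp,yp)$, with product determined by $[x,y][y,z]=[x,z]$; every element has the form $[t\pi,s]$ with $t,s$ trees and $\pi$ a permutation (cyclic for $G^T$). In the formula $[t\pi,s]\mapsto\chi(t)-\chi(s)$ one computes with any coloured trees representing $t$ and $s$. *)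

(* Defs.v *)
From HB Require Import structures.
From Stdlib Require Import Relation_Operators.
From mathcomp Require Import all_boot all_order all_algebra all_fingroup.
From mathcomp Require Import boolp classical_sets freeg ring_quotient generic_quotient.

Set Implicit Arguments.
Unset Strict Implicit.
Unset Printing Implicit Defensive.

Inductive tree (S : Type) : Type :=
| Leaf
| Node of S & tree S & tree S.
Arguments Leaf {S}.

HB.instance Definition _ (S : Type) := gen_eqMixin (tree S).
HB.instance Definition _ (S : Type) := gen_choiceMixin (tree S).

Fixpoint nleaves (S : Type) (t : tree S) : nat :=
  if t is Node _ t1 t2 then nleaves t1 + nleaves t2 else 1.

Fixpoint colours (S : Type) (t : tree S) : seq S :=
  if t is Node c t1 t2 then c :: colours t1 ++ colours t2 else [::].

Notation shape_of f := [seq nleaves t | t <- f].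
Notation fleaves f := (sumn (shape_of f)).

(* Glues the ith tree of g to the ith leaf of t; meaningful when g has exactly
   [nleaves t] trees. *)
Fixpoint graft (S : Type) (t : tree S) (g : seq (tree S)) : tree S :=
  if t is Node c t1 t2 then
    Node c (graft t1 (take (nleaves t1) g)) (graft t2 (drop (nleaves t1) g))
  else head Leaf g.

Definition fcomp (S : Type) (f g : seq (tree S)) : seq (tree S) :=
  [seq graft p.1 p.2 | p <- zip f (reshape (shape_of f) g)].
Arguments fcomp : simpl never.

Section ForestTheory.
Variable S : Type.
Implicit Types (t u : tree S) (f g h : seq (tree S)).

Lemma nleaves_gt0 t : 0 < nleaves t.
Proof. by elim: t => //= c t1 H1 t2 _; rewrite ltn_addr. Qed.

Lemma fcomp_cons t f g :
  fcomp (t :: f) g = graft t (take (nleaves t) g) :: fcomp f (drop (nleaves t) g).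
Proof. by []. Qed.

Lemma size_fcomp f g : size (fcomp f g) = size f.
Proof. by rewrite size_map size_zip size_reshape size_map minnn. Qed.

Lemma fcomp1 t g : size g = nleaves t -> fcomp [:: t] g = [:: graft t g].
Proof. by move=> sg; rewrite fcomp_cons take_oversize ?sg. Qed.

Lemma fcomp_cat f1 f2 g1 g2 : size g1 = fleaves f1 ->
  fcomp (f1 ++ f2) (g1 ++ g2) = fcomp f1 g1 ++ fcomp f2 g2.
Proof.
elim: f1 g1 => [|t f1 IH] g1 /=; first by case: g1.
move=> sg; rewrite !fcomp_cons take_cat drop_cat.
have [lt|] := ltnP (nleaves t) (size g1).
  by rewrite IH ?size_drop ?sg ?addKn.
rewrite sg -[leqRHS]addn0 leq_add2l leqn0 => /eqP f10.
rewrite f10 addn0 in sg *; rewrite subnn take0 drop0 cats0 take_oversize ?sg //.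
by rewrite drop_oversize ?sg // -(IH [::]) ?f10.
Qed.

Lemma nleaves_graft t g : size g = nleaves t -> nleaves (graft t g) = fleaves g.
Proof.
elim: t g => [|c t1 IH1 t2 IH2] g /=.
  by case: g => [|u []] //= _; rewrite addn0.
move=> sg; rewrite IH1 ?IH2; first by rewrite -sumn_cat -map_cat cat_take_drop.
  by rewrite size_drop sg addKn.
by rewrite size_takel // sg leq_addr.
Qed.

Lemma shape_fcomp f g : size g = fleaves f ->
  shape_of (fcomp f g) = map sumn (reshape (shape_of f) (shape_of g)).
Proof.
elim: f g => [|t f IH] g //= sg.
rewrite -map_drop -IH ?size_drop ?sg ?addKn // nleaves_graft ?map_take //.
by rewrite size_takel // sg leq_addr.
Qed.

Lemma fleaves_fcomp f g : size g = fleaves f -> fleaves (fcomp f g) = fleaves g.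
Proof.
move=> sg; rewrite shape_fcomp // -sumn_flatten reshapeKr //.
by rewrite size_map sg.
Qed.

Lemma fleaves_take_drop k f : fleaves (take k f) + fleaves (drop k f) = fleaves f.
Proof. by rewrite -sumn_cat -map_cat cat_take_drop. Qed.

Lemma graftA t g h : size g = nleaves t -> size h = fleaves g ->
  graft (graft t g) h = graft t (fcomp g h).
Proof.
elim: t g h => [|c t1 IH1 t2 IH2] g h /=.
  case: g => [|u []] //= _; rewrite addn0 => sh.
  by rewrite take_oversize ?sh.
move=> sg sh.
have s1 : size (take (nleaves t1) g) = nleaves t1.
  by rewrite size_takel // sg leq_addr.
have s2 : size (drop (nleaves t1) g) = nleaves t2 by rewrite size_drop sg addKn.
set k := fleaves (take (nleaves t1) g).
have kE : nleaves (graft t1 (take (nleaves t1) g)) = k by rewrite nleaves_graft.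
have kh : k <= size h by rewrite sh -(fleaves_take_drop (nleaves t1)) leq_addr.
have -> : fcomp g h = fcomp (take (nleaves t1) g) (take k h)
   ++ fcomp (drop (nleaves t1) g) (drop k h).
  by rewrite -fcomp_cat ?size_takel // !cat_take_drop.
rewrite kE take_size_cat ?size_fcomp // drop_size_cat ?size_fcomp //.
rewrite (IH1 _ _ s1) ?size_takel //.
rewrite (IH2 _ _ s2) //.
by rewrite size_drop sh -(fleaves_take_drop (nleaves t1)) addKn.
Qed.

Lemma fcompA f g h : size g = fleaves f -> size h = fleaves g ->
  fcomp (fcomp f g) h = fcomp f (fcomp g h).
Proof.
elim: f g h => [|t f IH] g h //= sg sh.
have s1 : size (take (nleaves t) g) = nleaves t.
  by rewrite size_takel // sg leq_addr.
set k := fleaves (take (nleaves t) g).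
have kE : nleaves (graft t (take (nleaves t) g)) = k by rewrite nleaves_graft.
have kh : k <= size h by rewrite sh -(fleaves_take_drop (nleaves t)) leq_addr.
have -> : fcomp g h = fcomp (take (nleaves t) g) (take k h)
   ++ fcomp (drop (nleaves t) g) (drop k h).
  by rewrite -fcomp_cat ?size_takel // !cat_take_drop.
rewrite !fcomp_cons take_size_cat ?size_fcomp // drop_size_cat ?size_fcomp //.
rewrite kE (graftA s1) ?size_takel // IH ?size_drop ?sg ?addKn //.
by rewrite sh -(fleaves_take_drop (nleaves t)) addKn.
Qed.

Lemma graft_id t : graft t (nseq (nleaves t) Leaf) = t.
Proof.
elim: t => //= c t1 IH1 t2 IH2.
by rewrite take_nseq ?leq_addr // drop_nseq addKn IH1 IH2.
Qed.

Lemma fcomp_id f : fcomp f (nseq (fleaves f) Leaf) = f.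
Proof.
elim: f => //= t f IH.
by rewrite fcomp_cons take_nseq ?leq_addr // drop_nseq addKn graft_id IH.
Qed.

Lemma nth_fcomp f g i : i < size f -> nth Leaf (fcomp f g) i =
  graft (nth Leaf f i) (nth [::] (reshape (shape_of f) g) i).
Proof.
move=> lti; have sz : size f = size (reshape (shape_of f) g).
  by rewrite size_reshape size_map.
rewrite (nth_map (Leaf, [::])) ?nth_zip //.
by rewrite size_zip -sz minnn.
Qed.

End ForestTheory.

(* The list of length n whose s(j)th entry is the jth entry of v. *)
Definition permseq (T : Type) (x0 : T) (n : nat) (s : 'S_n) (v : seq T) : seq T :=
  [seq nth x0 v ((s^-1)%g i) | i <- enum 'I_n].

Section PermSeq.
Variables (T : Type) (x0 : T) (n : nat).
Implicit Types (s : 'S_n) (v : seq T).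

Lemma size_permseq s v : size (permseq x0 s v) = n.
Proof. by rewrite size_map size_enum_ord. Qed.

Lemma nth_permseq y0 s v (i : 'I_n) : nth y0 (permseq x0 s v) i = nth x0 v ((s^-1)%g i).
Proof. by rewrite (nth_map i) ?size_enum_ord // nth_ord_enum. Qed.

Lemma eq_permseq s v w : size w = n ->
  (forall i : 'I_n, nth x0 v i = nth x0 w (s i)) -> permseq x0 s v = w.
Proof.
move=> sw H; apply: (@eq_from_nth _ x0) => [|i]; rewrite size_permseq ?sw // => li.
by rewrite -[i]/(val (Ordinal li)) nth_permseq H permKV.
Qed.

Lemma permseqM s s' v : permseq x0 (s' * s)%g v = permseq x0 s (permseq x0 s' v).
Proof.
apply: eq_permseq => [|i]; rewrite ?size_permseq //.
by rewrite permM !nth_permseq !permK.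
Qed.

Lemma permseq1 v : size v = n -> permseq x0 (1%g : 'S_n) v = v.
Proof. by move=> sv; apply: eq_permseq => // i; rewrite perm1. Qed.

End PermSeq.

Lemma map_permseq (T T' : Type) (x0 : T) (y0 : T') n (F : T -> T') (s : 'S_n) v :
  size v = n ->
  [seq F x | x <- permseq x0 s v] = permseq y0 s [seq F x | x <- v].
Proof.
move=> sv; apply: esym; apply: eq_permseq => [|i]; first by rewrite size_map size_permseq.
by rewrite !(nth_map x0) ?size_permseq ?sv // nth_permseq permK.
Qed.

Lemma zip_permseq (T T' : Type) (x0 : T) (y0 : T') n (s : 'S_n) v w :
  size v = n -> size w = n ->
  zip (permseq x0 s v) (permseq y0 s w) = permseq (x0, y0) s (zip v w).
Proof.
move=> sv sw; apply: esym; apply: eq_permseq => [|i].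
  by rewrite size_zip !size_permseq minnn.
by rewrite !nth_zip ?size_permseq ?sv // !nth_permseq permK.
Qed.

Lemma eq_perm_permseq n (s s' : 'S_n) :
  (forall v, size v = n -> permseq 0 s v = permseq 0 s' v) -> s = s'.
Proof.
move=> H; apply: invg_inj; apply/permP => i; apply: val_inj.
have := congr1 (nth 0 ^~ i) (H _ (size_iota 0 n)).
by rewrite !nth_permseq !nth_iota.
Qed.

Lemma sumn_permseq n (s : 'S_n) (v : seq nat) : size v = n ->
  sumn (permseq 0 s v) = sumn v.
Proof.
move=> sv; rewrite !sumnE big_map big_enum /= (big_nth 0) big_mkord sv.
by rewrite (reindex_inj (@perm_inj _ s)); apply: eq_bigr => i _; rewrite permK.
Qed.

Section BlockPerm.
Variables (n m : nat) (sh : seq nat).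
Hypotheses (size_sh : size sh = n) (sum_sh : sumn sh = m).
Implicit Types (s : 'S_n) (k : 'I_m).

Lemma block_subproof k : reshape_index sh k < n.
Proof. by rewrite -size_sh reshape_indexP // sum_sh. Qed.

Definition block k : 'I_n := Ordinal (block_subproof k).

Lemma nth_sh_permseq s k :
  reshape_offset sh k < nth 0 (permseq 0 s sh) (s (block k)).
Proof. by rewrite nth_permseq permK reshape_offsetP ?sum_sh. Qed.

Lemma block_fun_subproof s k :
  flatten_index (permseq 0 s sh) (s (block k)) (reshape_offset sh k) < m.
Proof.
rewrite -[X in _ < X]sum_sh -(sumn_permseq s size_sh) flatten_indexP //.
exact: nth_sh_permseq.
Qed.

(* In a list of n blocks of sizes sh, sends the position with offset o in block j
   to the position with offset o in block s(j) of the permuted list of blocks. *)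
Definition block_fun s k : 'I_m := Ordinal (block_fun_subproof s k).

Lemma block_fun_inj s : injective (block_fun s).
Proof.
move=> k k' /(congr1 val) /= E; apply: val_inj => /=.
have := congr1 (reshape_index (permseq 0 s sh)) E.
rewrite !flatten_indexKl ?nth_sh_permseq // => /val_inj/perm_inj.
move=> /(congr1 val)/= Eb.
have := congr1 (reshape_offset (permseq 0 s sh)) E.
rewrite !flatten_indexKr ?nth_sh_permseq // => Eo.
by rewrite -(reshape_indexK sh k) -(reshape_indexK sh k') Eb Eo.
Qed.

Definition blockperm s : 'S_m := perm (@block_fun_inj s).

Lemma shape_reshape (T : Type) (v : seq T) : size v = m -> shape (reshape sh v) = sh.
Proof. by move=> sv; rewrite reshapeKl // sv sum_sh. Qed.

Lemma permseq_blockperm (T : Type) (x0 : T) s (v : seq T) : size v = m ->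
  permseq x0 (blockperm s) v = flatten (permseq [::] s (reshape sh v)).
Proof.
move=> sv; have szr : size (reshape sh v) = n by rewrite size_reshape.
have shE : shape (permseq [::] s (reshape sh v)) = permseq 0 s sh.
  by rewrite /shape (map_permseq _ 0) //; congr permseq; exact: shape_reshape.
apply: eq_permseq => [|k]; first by rewrite size_flatten shE sumn_permseq.
rewrite permE nth_flatten shE /=.
rewrite flatten_indexKl ?flatten_indexKr ?nth_sh_permseq // nth_permseq permK /=.
rewrite -[in LHS](@reshapeKr _ sh v) ?sv ?sum_sh //.
by rewrite nth_flatten shape_reshape.
Qed.

End BlockPerm.

Definition rotation n : 'S_n := perm (@ordS_inj n).

Section Cyclic.
Variable n : nat.
Implicit Types (s : 'S_n).

Lemma permseq_rotationV (T : Type) (x0 : T) (v : seq T) : size v = n ->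
  permseq x0 (rotation n)^-1%g v = rot 1 v.
Proof.
move=> sv; apply: eq_permseq => [|i]; first by rewrite size_rot.
set j := (rotation n)^-1%g i; have -> : i = rotation n j by rewrite permKV.
rewrite permE /= /rot nth_cat size_drop sv nth_drop add1n.
have := ltn_ord j; case: (ltnP j n.-1) => [lt _|le lt].
  have lt' : j.+1 < n by rewrite -ltn_predRL.
  by rewrite modn_small // subn1 lt.
have n0 : 0 < n := leq_ltn_trans (leq0n j) lt.
have jE : j.+1 = n by apply/eqP; rewrite eqn_leq lt /= (leq_trans (leqSpred n)).
have -> : j.+1 %% n = 0 by rewrite jE modnn.
have -> : (j - (n - 1)) = 0 by apply/eqP; rewrite subn_eq0 subn1 -ltnS jE prednK.
by rewrite subn1 ltnNge le nth_take.
Qed.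

Lemma permseq_cyclic s : s \in <[rotation n]>%g -> exists2 j, j <= n &
  forall T (x0 : T) (v : seq T), size v = n -> permseq x0 s v = rot j v.
Proof.
rewrite -cycleV => /cycleP[k ->]; elim: k => [|k [j lej IH]].
  by exists 0 => // T x0 v sv; rewrite rot0 permseq1.
have [ltj|gej] := ltnP j n.
  exists j.+1 => // T x0 v sv; rewrite expgSr permseqM IH //.
  by rewrite permseq_rotationV ?size_rot // -rotS ?sv.
have {lej gej} jE : j = n by apply/eqP; rewrite eqn_leq lej.
exists (0 < n) => [|T x0 v sv]; first by case: (n).
rewrite expgSr permseqM IH // jE permseq_rotationV ?size_rot // -{1}sv rot_size.
by case: posnP => // n0; case: v sv => //; rewrite n0.
Qed.

Lemma permseq_rot_cyclic j s : j <= n ->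
  (forall v : seq nat, size v = n -> permseq 0 s v = rot j v) ->
  s \in <[rotation n]>%g.
Proof.
move=> lej H; suff -> : s = ((rotation n)^-1 ^+ j)%g by rewrite -cycleV mem_cycle.
apply: eq_perm_permseq => v sv; rewrite H //.
elim: j lej {H} => [|j IH] ltj; first by rewrite rot0 permseq1.
rewrite expgSr permseqM -IH 1?ltnW // permseq_rotationV ?size_rot //.
by rewrite -rotS ?sv.
Qed.

End Cyclic.

Lemma blockperm_cyclic n m sh (size_sh : size sh = n) (sum_sh : sumn sh = m) s : s \in <[rotation n]>%g ->
  blockperm size_sh sum_sh s \in <[rotation m]>%g.
Proof.
case/permseq_cyclic => j lej H.
apply: (@permseq_rot_cyclic _ (sumn (take j sh))).
  by rewrite -sum_sh -{2}(cat_take_drop j sh) sumn_cat leq_addr.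
move=> v sv; rewrite permseq_blockperm // H ?size_reshape //.
rewrite /rot flatten_cat -{3 4}(@reshapeKr _ sh v) ?sv ?sum_sh //.
rewrite -{3 4}(cat_take_drop j (reshape sh v)) flatten_cat.
have -> : sumn (take j sh) = size (flatten (take j (reshape sh v))).
  by rewrite size_flatten /shape map_take -/(shape _) (shape_reshape sum_sh).
by rewrite drop_size_cat ?take_size_cat.
Qed.

Lemma blockpermM n m sh sh' (ssh : size sh = n) (msh : sumn sh = m)
    (ssh' : size sh' = n) (msh' : sumn sh' = m) (s t : 'S_n) :
  sh' = permseq 0 t sh ->
  blockperm ssh msh (t * s)%g = (blockperm ssh msh t * blockperm ssh' msh' s)%g.
Proof.
move=> shE; apply: eq_perm_permseq => v sv.
have shE' : shape (permseq [::] t (reshape sh v)) = sh'.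
  rewrite /shape (map_permseq _ 0) ?size_reshape // shE.
  by congr permseq; rewrite -/(shape _) (shape_reshape msh).
rewrite permseqM !permseq_blockperm ?size_flatten ?shE' //.
by rewrite permseqM -shE' flattenK.
Qed.

Lemma blockpermK n m p sh sh' (ssh : size sh = n) (msh : sumn sh = m)
    (ssh' : size sh' = m) (msh' : sumn sh' = p) sh'' (ssh'' : size sh'' = n)
    (msh'' : sumn sh'' = p) (s : 'S_n) :
  sh'' = map sumn (reshape sh sh') ->
  blockperm ssh'' msh'' s = blockperm ssh' msh' (blockperm ssh msh s).
Proof.
move=> shE; apply: eq_perm_permseq => v sv.
have sr : size (reshape sh' v) = m by rewrite size_reshape.
rewrite !permseq_blockperm //.
have szr : size (reshape sh (reshape sh' v)) = n by rewrite size_reshape.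
have -> : flatten (flatten (permseq [::] s (reshape sh (reshape sh' v))))
  = flatten (map flatten (permseq [::] s (reshape sh (reshape sh' v)))).
  by elim: (permseq _ _ _) => //= x w IH; rewrite flatten_cat IH.
rewrite (map_permseq _ [::]) //; congr (flatten (permseq _ _ _)).
apply: eq_from_flatten_shape.
  rewrite reshapeKr ?sv ?msh'' //.
  have -> : flatten (map flatten (reshape sh (reshape sh' v)))
    = flatten (flatten (reshape sh (reshape sh' v))).
    by elim: (reshape sh (reshape _ _)) => //= x w ->; rewrite flatten_cat.
  by rewrite !reshapeKr ?sv ?msh' ?sr ?msh.
rewrite (shape_reshape msh'') // shE -[X in reshape sh X](shape_reshape msh' sv).
rewrite /shape -map_reshape -!map_comp; apply: eq_map => w /=.
by rewrite size_flatten.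
Qed.

(* A morphism l -> r of the free category: r >= 1 roots and l leaves. *)
Record forest (S : Type) (l r : nat) := Forest {
  fseq :> seq (tree S);
  forest_subproof : [&& 0 < r, size fseq == r & fleaves fseq == l] }.

HB.instance Definition _ (S : Type) l r := [isSub for @fseq S l r].
HB.instance Definition _ (S : Type) l r := [Choice of forest S l r by <:].

Record skein (S : Type) := Skein {
  lhs : tree S;
  rhs : tree S;
  nleaves_skein : nleaves lhs = nleaves rhs }.

(* The congruence generated by R. On empty lists, which are not forests, it
   reduces to equality, so allowing them in the rules adds nothing. *)
Inductive skein_eq (S : Type) (R : set (skein S)) :
    seq (tree S) -> seq (tree S) -> Prop :=
| skein_base u : R u -> skein_eq R [:: lhs u] [:: rhs u]
| skein_refl f : skein_eq R f f
| skein_sym f g : skein_eq R f g -> skein_eq R g f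
| skein_trans f g h : skein_eq R f g -> skein_eq R g h -> skein_eq R f h
| skein_comp f f' g g' : fleaves f = size g -> fleaves f' = size g' ->
    skein_eq R f f' -> skein_eq R g g' -> skein_eq R (fcomp f g) (fcomp f' g')
| skein_tensor f f' g g' :
    skein_eq R f f' -> skein_eq R g g' -> skein_eq R (f ++ g) (f' ++ g').

Section Forests.
Variable S : Type.

Lemma forest_gt0 l r (f : forest S l r) : 0 < r.
Proof. by case: f => f /= /and3P[]. Qed.

Lemma size_forest l r (f : forest S l r) : size f = r.
Proof. by case: f => f /= /and3P[_ /eqP]. Qed.

Lemma size_shape l r (f : forest S l r) : size (shape_of f) = r.
Proof. by rewrite size_map size_forest. Qed.

Lemma fleaves_forest l r (f : forest S l r) : fleaves f = l.
Proof. by case: f => f /= /and3P[_ _ /eqP]. Qed.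

Lemma tree_forest_subproof l (t : tree S) : nleaves t = l ->
  [&& 0 < 1, size [:: t] == 1 & fleaves [:: t] == l].
Proof. by move=> <-; rewrite /= addn0 eqxx. Qed.

Definition tree_forest l (t : tree S) (tl : nleaves t = l) : forest S l 1 :=
  Forest (tree_forest_subproof tl).

Lemma forest_id_subproof n : 0 < n ->
  [&& 0 < n, size (nseq n (@Leaf S)) == n & fleaves (nseq n (@Leaf S)) == n].
Proof. by move=> n0; rewrite n0 size_nseq eqxx map_nseq sumn_nseq mul1n eqxx. Qed.

Definition forest_id n (n0 : 0 < n) : forest S n n :=
  Forest (forest_id_subproof n0).

Lemma forest_comp_subproof l m r (f : forest S m r) (g : forest S l m) :
  [&& 0 < r, size (fcomp f g) == r & fleaves (fcomp f g) == l].
Proof.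
rewrite (forest_gt0 f) size_fcomp size_forest fleaves_fcomp ?fleaves_forest ?eqxx //.
by rewrite size_forest.
Qed.

Definition forest_comp l m r (f : forest S m r) (g : forest S l m) : forest S l r :=
  Forest (forest_comp_subproof f g).

Lemma forest_perm_subproof l r (s : 'S_r) (g : forest S l r) :
  [&& 0 < r, size (permseq Leaf s g) == r & fleaves (permseq Leaf s g) == l].
Proof.
rewrite (forest_gt0 g) size_permseq (map_permseq _ 0) ?size_forest //.
by rewrite sumn_permseq ?size_shape // fleaves_forest !eqxx.
Qed.

(* g^s *)
Definition forest_perm l r (s : 'S_r) (g : forest S l r) : forest S l r :=
  Forest (forest_perm_subproof s g).

(* s^g *)
Definition forest_block l r (s : 'S_r) (g : forest S l r) : 'S_l :=
  blockperm (size_shape g) (fleaves_forest g) s.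

Variable R : set (skein S).
Implicit Types (f g h : seq (tree S)).
Notation skein_eq := (skein_eq R).

Lemma skein_eq_shape f g : skein_eq f g -> shape_of f = shape_of g.
Proof.
elim=> {f g} //=.
- by move=> u _; rewrite nleaves_skein.
- by move=> f g h _ -> _ ->.
- by move=> f f' g g' s s' _ Ef _ Eg; rewrite !shape_fcomp // Ef Eg.
- by move=> f f' g g' _ Ef _ Eg; rewrite !map_cat Ef Eg.
Qed.

Lemma skein_eq_size f g : skein_eq f g -> size f = size g.
Proof. by move/skein_eq_shape/(congr1 size); rewrite !size_map. Qed.

Lemma nth_skein_eq f g : size f = size g ->
  (forall i, i < size f -> skein_eq [:: nth Leaf f i] [:: nth Leaf g i]) ->
  skein_eq f g.
Proof.
elim: f g => [|t f IH] [|u g] //=; first by move=> _ _; exact: skein_refl.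
case=> sz H; rewrite -cat1s -[u :: g]cat1s; apply: skein_tensor.
  exact: (H 0).
by apply: IH => // i lti; exact: (H i.+1).
Qed.

Lemma skein_eq_nth f g i :
  skein_eq f g -> skein_eq [:: nth Leaf f i] [:: nth Leaf g i].
Proof.
have [lti|gei] := ltnP i (size f); last first.
  move=> /skein_eq_size E; rewrite !nth_default -?E //; exact: skein_refl.
move=> E; elim: E i lti => {f g}.
- by move=> u Ru [|i] //= _; exact: skein_base.
- by move=> f i _; exact: skein_refl.
- by move=> f g E IH i lti; apply/skein_sym/IH; rewrite (skein_eq_size E).
- move=> f g h E IH _ IH' i lti; apply: skein_trans (IH _ lti) (IH' _ _).
  by rewrite -(skein_eq_size E).
- move=> f f' g g' s s' E IH E' IH' i; rewrite size_fcomp => lti.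
  have lti' : i < size f' by rewrite -(skein_eq_size E).
  have sz (h k : seq (tree S)) : fleaves h = size k -> i < size h ->
    size (nth [::] (reshape (shape_of h) k) i) = nleaves (nth Leaf h i).
    move=> szhk lt; rewrite -(nth_map [::] 0 size) ?size_reshape ?size_map //.
    by rewrite -/(shape _) reshapeKl ?szhk // (nth_map Leaf).
  rewrite !nth_fcomp // -!fcomp1 ?sz //; apply: skein_comp.
  + by rewrite /= addn0 sz.
  + by rewrite /= addn0 sz.
  + exact: IH.
  rewrite !nth_reshape (skein_eq_shape E); set a := nth _ _ _; set b := sumn _.
  apply: nth_skein_eq => [|j]; rewrite !size_take_min !size_drop (skein_eq_size E') //.
  rewrite leq_min => /andP[lta ltb].
  rewrite !nth_take // !nth_drop; apply: IH'.
  by rewrite (skein_eq_size E') -ltn_subRL.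
- move=> f f' g g' E IH E' IH' i; rewrite size_cat => lti; rewrite !nth_cat -(skein_eq_size E).
  case: ltnP => [lti'|gei]; first exact: IH.
  by apply: IH'; rewrite ltn_subLR.
Qed.

Lemma skein_eq_permseq n (s : 'S_n) f g :
  skein_eq f g -> skein_eq (permseq Leaf s f) (permseq Leaf s g).
Proof.
move=> E; apply: nth_skein_eq => [|i]; rewrite !size_permseq // => lti.
by rewrite -[i]/(val (Ordinal lti)) !nth_permseq; exact: skein_eq_nth.
Qed.

End Forests.

Section Category.
Local Open Scope quotient_scope.
Variables (S : Type) (R : set (skein S)).

Definition skein_rel l r (f g : forest S l r) : bool := `[< skein_eq R f g >].

Lemma skein_rel_equiv l r : equiv_class_of (@skein_rel l r).
Proof.
split=> [f|f g|g f h].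
- by apply/asboolP; exact: skein_refl.
- by apply/asboolP/asboolP; exact: skein_sym.
- by move=> /asboolP E /asboolP E'; apply/asboolP; exact: skein_trans E E'.
Qed.

Canonical skein_equiv l r := EquivRelPack (@skein_rel_equiv l r).

(* Hom(l, r) in FS<S|R>; repr picks some forest in each class, and the operations
   below do not depend on it (see FS_compE, FS_permE and FS_blockE). *)
Definition FS l r := {eq_quot (@skein_equiv l r)}.
HB.instance Definition _ l r := Choice.on (FS l r).
HB.instance Definition _ l r := Quotient.on (FS l r).
HB.instance Definition _ l r : EqQuotient _ (@skein_equiv l r) (FS l r) :=
  EqQuotient.on (FS l r).

Notation cls := (\pi_(FS _ _)).

Definition FS_tree l (t : tree S) (tl : nleaves t = l) : FS l 1 :=
  cls (tree_forest tl).

Definition FS_id n (n0 : 0 < n) : FS n n := cls (forest_id S n0).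

Definition FS_comp l m r (f : FS m r) (g : FS l m) : FS l r :=
  cls (forest_comp (repr f) (repr g)).

Definition FS_perm l r (s : 'S_r) (g : FS l r) : FS l r :=
  cls (forest_perm s (repr g)).

Definition FS_block l r (s : 'S_r) (g : FS l r) : 'S_l :=
  forest_block s (repr g).

Definition left_cancellative : Prop :=
  forall l m r (f : FS m r) (g h : FS l m), FS_comp f g = FS_comp f h -> g = h.

Definition has_common_right_multiples : Prop :=
  forall m n r (f : FS m r) (g : FS n r),
    exists l, exists (h : FS l m) (k : FS l n), FS_comp f h = FS_comp g k.

Definition Ore : Prop := left_cancellative /\ has_common_right_multiples.

Lemma FS_eqP l r (f g : forest S l r) :
  cls f = cls g <-> skein_eq R f g.
Proof. by split=> [/eqmodP/asboolP|E] //; apply/eqmodP/asboolP. Qed.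

Lemma skein_repr l r (f : forest S l r) : skein_eq R (repr (cls f)) f.
Proof. by apply/FS_eqP; rewrite reprK. Qed.

Lemma FS_compE l m r (f : forest S m r) (g : forest S l m) :
  FS_comp (cls f) (cls g) = cls (forest_comp f g).
Proof.
apply/FS_eqP; apply: skein_comp; rewrite ?size_forest ?fleaves_forest //;
  exact: skein_repr.
Qed.

Lemma FS_permE l r (s : 'S_r) (g : forest S l r) :
  FS_perm s (cls g) = cls (forest_perm s g).
Proof. by apply/FS_eqP/skein_eq_permseq/skein_repr. Qed.

Lemma forest_block_shape l r (s : 'S_r) (g h : forest S l r) :
  shape_of g = shape_of h -> forest_block s g = forest_block s h.
Proof.
move=> E; rewrite /forest_block; move: (size_shape g) (fleaves_forest g).
by rewrite E => p q; congr (blockperm _ _ s); exact: eq_irrelevance.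
Qed.

Lemma FS_blockE l r (s : 'S_r) (g : forest S l r) :
  FS_block s (cls g) = forest_block s g.
Proof. by apply/forest_block_shape/skein_eq_shape/skein_repr. Qed.

Lemma FS_ind l r (P : FS l r -> Prop) : (forall f, P (cls f)) -> forall f, P f.
Proof. by move=> H f; rewrite -[f]reprK. Qed.

Lemma FS_gt0 l r (f : FS l r) : 0 < r.
Proof. exact: forest_gt0 (repr f). Qed.

Lemma FS_leaves_gt0 l r (f : FS l r) : 0 < l.
Proof.
rewrite -(fleaves_forest (repr f)); case: (repr f) => -[|t u] /= /and3P[].
  by case: r {f}.
by move=> _ _ _; rewrite ltn_addr // nleaves_gt0.
Qed.

Lemma FS_compA k l m r (f : FS m r) (g : FS l m) (h : FS k l) :
  FS_comp (FS_comp f g) h = FS_comp f (FS_comp g h).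
Proof.
elim/FS_ind: f => f; elim/FS_ind: g => g; elim/FS_ind: h => h.
rewrite !FS_compE; congr (cls _); apply: val_inj => /=.
by rewrite fcompA // ?size_forest ?fleaves_forest.
Qed.

Lemma FS_comp_id m r (f : FS m r) (m0 : 0 < m) : FS_comp f (FS_id m0) = f.
Proof.
elim/FS_ind: f => f; rewrite FS_compE; congr (cls _); apply: val_inj => /=.
by rewrite -[in nseq m](fleaves_forest f) fcomp_id.
Qed.

Lemma FS_permM l r (s t : 'S_r) (g : FS l r) :
  FS_perm (t * s)%g g = FS_perm s (FS_perm t g).
Proof.
elim/FS_ind: g => g; rewrite !FS_permE; congr (cls _); apply: val_inj => /=.
by rewrite permseqM.
Qed.

Lemma FS_perm1 l r (g : FS l r) : FS_perm 1%g g = g.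
Proof.
elim/FS_ind: g => g; rewrite FS_permE; congr (cls _); apply: val_inj => /=.
by rewrite permseq1 ?size_forest.
Qed.

Lemma FS_permK l r (s : 'S_r) : cancel (@FS_perm l r s) (FS_perm s^-1%g).
Proof. by move=> g; rewrite -FS_permM mulgV FS_perm1. Qed.

Lemma FS_permKV l r (s : 'S_r) : cancel (@FS_perm l r s^-1%g) (FS_perm s).
Proof. by move=> g; rewrite -FS_permM mulVg FS_perm1. Qed.

Lemma FS_perm_comp l m r (s : 'S_r) (f : FS m r) (g : FS l m) :
  FS_perm s (FS_comp f g) = FS_comp (FS_perm s f) (FS_perm (FS_block s f) g).
Proof.
elim/FS_ind: f => f; elim/FS_ind: g => g.
rewrite FS_blockE FS_compE !FS_permE FS_compE; congr (cls _); apply: val_inj => /=.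
have sg : size (reshape (shape_of f) g) = r by rewrite size_reshape size_shape.
rewrite permseq_blockperm ?size_forest // /fcomp.
rewrite -(map_permseq (Leaf, [::])) ?size_zip ?sg ?size_forest ?minnn //.
congr map; rewrite -zip_permseq ?size_forest //; congr zip.
have -> : shape_of (permseq Leaf s f) = shape (permseq [::] s (reshape (shape_of f) g)).
  rewrite (map_permseq _ 0) ?size_forest // /shape (map_permseq _ 0) //.
  congr permseq; rewrite -/(shape _) reshapeKl //.
  by rewrite fleaves_forest size_forest.
by rewrite flattenK.
Qed.

Lemma FS_blockM l r (s t : 'S_r) (g : FS l r) :
  FS_block (t * s)%g g = (FS_block t g * FS_block s (FS_perm t g))%g.
Proof.
elim/FS_ind: g => g; rewrite FS_permE !FS_blockE; apply: blockpermM.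
by rewrite /= (map_permseq _ 0) ?size_forest.
Qed.

Lemma FS_block_comp l m r (s : 'S_r) (f : FS m r) (g : FS l m) :
  FS_block s (FS_comp f g) = FS_block (FS_block s f) g.
Proof.
elim/FS_ind: f => f; elim/FS_ind: g => g; rewrite FS_compE !FS_blockE.
by apply: blockpermK; rewrite /= shape_fcomp // size_forest fleaves_forest.
Qed.

Lemma FS_block_cyclic l r (s : 'S_r) (g : FS l r) :
  s \in <[rotation r]>%g -> FS_block s g \in <[rotation l]>%g.
Proof. exact: blockperm_cyclic. Qed.

Lemma FS_perm_id n (n0 : 0 < n) (s : 'S_n) : FS_perm s (FS_id n0) = FS_id n0.
Proof.
rewrite /FS_id FS_permE; congr (cls _); apply: val_inj => /=.
by apply: eq_permseq => [|i]; rewrite ?size_nseq // !nth_nseq !if_same.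
Qed.

Lemma FS_block_id n (n0 : 0 < n) (s : 'S_n) : FS_block s (FS_id n0) = s.
Proof.
rewrite /FS_id FS_blockE; apply: eq_perm_permseq => v sv.
rewrite permseq_blockperm //=.
have -> : reshape [seq nleaves t | t <- nseq n (@Leaf S)] v = [seq [:: x] | x <- v].
  by rewrite -sv; elim: v {sv} => //= x v IH; rewrite take0 drop0 IH.
by rewrite -(map_permseq 0) // flatten_seq1.
Qed.

End Category.

(* KindT and KindV select F^T, G^T and F^V, G^V respectively. *)
Variant kind := KindT | KindV.

Definition Sigma (Y : kind) (l : nat) : {group 'S_l} :=
  if Y is KindT then <[rotation l]>%G else [set: 'S_l]%G.

Lemma FS_block_Sigma (S : Type) (R : set (skein S)) Y l r (s : 'S_r) (g : FS R l r) :
  s \in Sigma Y r -> FS_block s g \in Sigma Y l.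
Proof. by case: Y => /= Ys; [exact: FS_block_cyclic|rewrite inE]. Qed.

Section PermutedForests.
Variables (S : Type) (R : set (skein S)) (Y : kind).

(* Hom(l, r) in F^Y. *)
Definition FSY l r : Type := (FS R l r * [subg Sigma Y l])%type.
HB.instance Definition _ l r := Choice.on (FSY l r).

Lemma FSY_comp_subproof l m r (x : FSY m r) (y : FSY l m) :
  (sgval y.2 * FS_block (sgval x.2) y.1)%g \in Sigma Y l.
Proof.
by rewrite groupM ?FS_block_Sigma ?subgP.
Qed.

(* Products in 'S_l apply the left factor first, so the second component is the
   composite function s^g \o t, where x = (f, s) and y = (g, t). *)
Definition FSY_comp l m r (x : FSY m r) (y : FSY l m) : FSY l r :=
  (FS_comp x.1 (FS_perm (sgval x.2) y.1), Subg (FSY_comp_subproof x y)).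

Definition FSY_id n (n0 : 0 < n) : FSY n n := (FS_id R n0, 1%g).

Lemma FSY_eq l r (x y : FSY l r) : x.1 = y.1 -> sgval x.2 = sgval y.2 -> x = y.
Proof. by case: x y => [f s] [g t] /= -> /val_inj ->. Qed.

Lemma FSY_compA k l m r (x : FSY m r) (y : FSY l m) (z : FSY k l) :
  FSY_comp (FSY_comp x y) z = FSY_comp x (FSY_comp y z).
Proof.
apply: FSY_eq => /=; first by rewrite FS_permM FS_compA FS_perm_comp.
by rewrite FS_blockM FS_block_comp mulgA.
Qed.

Lemma FSY_comp_id m r (x : FSY m r) (m0 : 0 < m) : FSY_comp x (FSY_id m0) = x.
Proof.
apply: FSY_eq => /=; first by rewrite FS_perm_id FS_comp_id.
by rewrite FS_block_id mul1g.
Qed.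

Lemma FSY_cancel : left_cancellative R ->
  forall l m r (x : FSY m r) (y z : FSY l m), FSY_comp x y = FSY_comp x z -> y = z.
Proof.
move=> oreR l m r x y z E.
have E1 : y.1 = z.1.
  by have /oreR/(can_inj (FS_permK _)) := congr1 fst E.
apply: FSY_eq => //; have /(congr1 sgval) /= := congr1 snd E.
by rewrite E1 => /mulIg.
Qed.

Lemma FSY_multiples : has_common_right_multiples R ->
  forall m n r (x : FSY m r) (y : FSY n r),
    exists l, exists (p : FSY l m) (q : FSY l n), FSY_comp x p = FSY_comp y q.
Proof.
move=> oreR m n r x y; have [l [h [k E]]] := oreR _ _ _ x.1 y.1; exists l.
have unperm j (z : FSY j r) (f : FS R l j) :
    exists p : FSY l j, FSY_comp z p = (FS_comp z.1 f, 1%g).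
  set g := FS_perm (sgval z.2)^-1%g f.
  have Sg : (FS_block (sgval z.2) g)^-1%g \in Sigma Y l.
    by rewrite groupV FS_block_Sigma ?subgP.
  exists (g, Subg Sg); apply: FSY_eq => /=; first by rewrite /g FS_permKV.
  by rewrite mulVg.
have [p Ep] := unperm _ x h; have [q Eq] := unperm _ y k.
by exists p, q; rewrite Ep Eq E.
Qed.

Definition fraction : Type := {l : nat & (FSY l 1 * FSY l 1)%type}.
HB.instance Definition _ := Choice.on fraction.

Definition Fraction l (x y : FSY l 1) : fraction := existT _ l (x, y).

Inductive fraction_step : fraction -> fraction -> Prop :=
| FractionStep l m (x y : FSY l 1) (p : FSY m l) :
    fraction_step (Fraction x y) (Fraction (FSY_comp x p) (FSY_comp y p)).

Definition fraction_rel (u v : fraction) : bool :=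
  `[< clos_refl_sym_trans _ fraction_step u v >].

Lemma fraction_rel_equiv : equiv_class_of fraction_rel.
Proof.
split=> [u|u v|u v w].
- by apply/asboolP; exact: rst_refl.
- by apply/asboolP/asboolP; exact: rst_sym.
- by move=> /asboolP E /asboolP E'; apply/asboolP; exact: rst_trans E E'.
Qed.

Canonical fraction_equiv := EquivRelPack fraction_rel_equiv.

End PermutedForests.

Definition FSgroup (S : Type) (R : set (skein S)) (oreR : Ore R) (Y : kind) :
  Type := {eq_quot (fraction_equiv R Y)}%qT.

Section Group.
Local Open Scope quotient_scope.
Variables (S : Type) (R : set (skein S)) (oreR : Ore R) (Y : kind).
Notation G := (FSgroup oreR Y).

HB.instance Definition _ := Choice.on G.
HB.instance Definition _ := Quotient.on G.
HB.instance Definition _ : EqQuotient _ (fraction_equiv R Y) G :=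
  EqQuotient.on G.

Notation FSY := (FSY R Y).

Definition FSfrac l (x y : FSY l 1) : G := \pi_G (Fraction x y).

Definition fractions_agree (u v : fraction R Y) : Prop :=
  exists k, exists (p : FSY k (tag u)) (q : FSY k (tag v)),
    FSY_comp (tagged u).1 p = FSY_comp (tagged v).1 q /\
    FSY_comp (tagged u).2 p = FSY_comp (tagged v).2 q.

Lemma fractions_agreeP u v :
  reflect (fractions_agree u v) (fraction_rel u v).
Proof.
apply: (iffP (asboolP _)) => [|[k [p [q []]]]]; last first.
  case: u v p q => [l [x y]] [m [z w]] /= p q E1 E2.
  apply: rst_trans (rst_step _ _ _ _ (FractionStep x y p)) _.
  by rewrite E1 E2; apply/rst_sym/rst_step; exact: (FractionStep z w q).
elim=> {u v}.
- move=> _ _ [l m x y p] /=.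
  have m0 : 0 < m := FS_leaves_gt0 p.1.
  by exists m, p, (FSY_id R Y m0); rewrite /= !FSY_comp_id.
- move=> [l [x y]]; have l0 : 0 < l := FS_leaves_gt0 x.1.
  by exists l, (FSY_id R Y l0), (FSY_id R Y l0).
- by move=> u v _ [k [p [q [E1 E2]]]]; exists k, q, p.
move=> u v w _ [k [p [q [E1 E2]]]] _ [k' [p' [q' [E1' E2']]]].
have [j [h [h' E]]] := FSY_multiples oreR.2 q p'.
exists j, (FSY_comp p h), (FSY_comp q' h'); rewrite -!FSY_compA E1 E2 -E1' -E2'.
by rewrite !FSY_compA E.
Qed.

Lemma FSfracP l m (x y : FSY l 1) (z w : FSY m 1) :
  FSfrac x y = FSfrac z w <-> exists k, exists (p : FSY k l) (q : FSY k m),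
    FSY_comp x p = FSY_comp z q /\ FSY_comp y p = FSY_comp w q.
Proof. by split=> [/eqmodP/fractions_agreeP|H] //; apply/eqmodP/fractions_agreeP. Qed.

Lemma FSfrac_ind (P : G -> Prop) :
  (forall l (x y : FSY l 1), P (FSfrac x y)) -> forall g, P g.
Proof. by move=> H g; rewrite -[g]reprK; case: (repr g) => l [x y]; exact: H. Qed.

Lemma FSfrac_comp l m (x y : FSY l 1) (p : FSY m l) :
  FSfrac (FSY_comp x p) (FSY_comp y p) = FSfrac x y.
Proof. by apply/eqmodP/asboolP/rst_sym/rst_step; exact: FractionStep. Qed.

Lemma FSfrac_common (g h : G) :
  exists l, exists x y z : FSY l 1, g = FSfrac x y /\ h = FSfrac y z.
Proof.
elim/FSfrac_ind: g => l x y; elim/FSfrac_ind: h => m z w.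
have [k [p [q E]]] := FSY_multiples oreR.2 y z.
exists k, (FSY_comp x p), (FSY_comp y p), (FSY_comp w q).
by rewrite FSfrac_comp E FSfrac_comp.
Qed.

Lemma tree_id_subproof : 0 < 1. Proof. by []. Qed.

Definition FSgroup_one : G :=
  FSfrac (FSY_id R Y tree_id_subproof) (FSY_id R Y tree_id_subproof).

(* The product is determined by [x, y][y, z] = [x, z]; see FSgroup_mulE. *)
Definition FSgroup_mul (g h : G) : G :=
  xget g [set k | exists l, exists x y z : FSY l 1,
    [/\ g = FSfrac x y, h = FSfrac y z & k = FSfrac x z]].

Definition FSgroup_inv (g : G) : G :=
  let: existT l (x, y) := repr g in FSfrac y x.

Lemma FSgroup_mulE l (x y z : FSY l 1) :
  FSgroup_mul (FSfrac x y) (FSfrac y z) = FSfrac x z.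
Proof.
rewrite /FSgroup_mul; case: xgetP => [k _ [m [x' [y' [z' [E1 E2 ->]]]]]|H]; last first.
  by case: (H (FSfrac x z)); exists l, x, y, z.
have /FSfracP[j [p [p' [Ex Ey]]]] := E1; have /FSfracP[j' [q [q' [Ey' Ez]]]] := E2.
have [i [h [h' E]]] := FSY_multiples oreR.2 p q.
apply/FSfracP; exists i, (FSY_comp p' h), (FSY_comp p h); split.
  by rewrite -!FSY_compA Ex.
suff E' : FSY_comp p' h = FSY_comp q' h'.
  by rewrite E' -FSY_compA -Ez FSY_compA -E.
apply: (FSY_cancel oreR.1 (x := y')).
by rewrite -!FSY_compA -Ey -Ey' !FSY_compA E.
Qed.

Lemma FSfrac_diag l m (x : FSY l 1) (y : FSY m 1) : FSfrac x x = FSfrac y y.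
Proof.
have [k [p [q E]]] := FSY_multiples oreR.2 x y.
by apply/FSfracP; exists k, p, q.
Qed.

Lemma FSgroup_invE l (x y : FSY l 1) : FSgroup_inv (FSfrac x y) = FSfrac y x.
Proof.
rewrite /FSgroup_inv; have : FSfrac x y = \pi_G (repr (FSfrac x y)) by rewrite reprK.
case: (repr _) => m [z w] /FSfracP[k [p [q [E1 E2]]]].
by apply/FSfracP; exists k, q, p.
Qed.

Lemma FSfrac_tree_perm (g : G) : exists l (t s : tree S) (tl : nleaves t = l)
    (sl : nleaves s = l) (p : 'S_l) (Yp : p \in Sigma Y l),
  g = FSfrac (FS_tree R tl, Subg Yp) (FS_tree R sl, 1%g).
Proof.
have FS_treeP l (f : FS R l 1) : exists t (tl : nleaves t = l), f = FS_tree R tl.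
  elim/FS_ind: f => f; have := size_forest f; have := fleaves_forest f.
  case E : (fseq f) => [|t []] //=; rewrite addn0 => tl _.
  by exists t, tl; congr (\pi_(FS R l 1) _); apply: val_inj.
elim/FSfrac_ind: g => l x y; have l0 := FS_leaves_gt0 x.1.
pose p : FSY l l := (FS_id R l0, (y.2^-1)%g).
have [t [tl Et]] := FS_treeP _ (FSY_comp x p).1.
have [s [sl Es]] := FS_treeP _ (FSY_comp y p).1.
exists l, t, s, tl, sl, (sgval (FSY_comp x p).2), (subgP _).
rewrite -(FSfrac_comp x y p); congr FSfrac; first exact: FSY_eq.
apply: FSY_eq => //=; rewrite FS_block_id; case: (y.2) => w Yw /=.
by rewrite mulVg.
Qed.

Lemma FSgroup_mulA : associative FSgroup_mul.
Proof.
move=> g h i; have [l [x [y [z [-> ->]]]]] := FSfrac_common g h.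
elim/FSfrac_ind: i => m t w; have [k [p [q E]]] := FSY_multiples oreR.2 z t.
rewrite FSgroup_mulE -(FSfrac_comp x y p) -(FSfrac_comp y z p) -(FSfrac_comp x z p).
by rewrite -(FSfrac_comp t w q) -E !FSgroup_mulE.
Qed.

Lemma FSgroup_mul1 : left_id FSgroup_one FSgroup_mul.
Proof.
by elim/FSfrac_ind => l x y; rewrite /FSgroup_one (FSfrac_diag _ x) FSgroup_mulE.
Qed.

Lemma FSgroup_mulr1 : right_id FSgroup_one FSgroup_mul.
Proof.
by elim/FSfrac_ind => l x y; rewrite /FSgroup_one (FSfrac_diag _ y) FSgroup_mulE.
Qed.

Lemma FSgroup_mulV : left_inverse FSgroup_one FSgroup_inv FSgroup_mul.
Proof.
elim/FSfrac_ind => l x y; rewrite FSgroup_invE FSgroup_mulE; exact: FSfrac_diag.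
Qed.

Lemma FSgroup_mulrV : right_inverse FSgroup_one FSgroup_inv FSgroup_mul.
Proof.
elim/FSfrac_ind => l x y; rewrite FSgroup_invE FSgroup_mulE; exact: FSfrac_diag.
Qed.

End Group.

HB.instance Definition _ (S : Type) (R : set (skein S)) (oreR : Ore R) (Y : kind) :=
  isGroup.Build (FSgroup oreR Y) (@FSgroup_mulA _ _ oreR Y) (@FSgroup_mul1 _ _ oreR Y)
    (@FSgroup_mulr1 _ _ oreR Y) (@FSgroup_mulV _ _ oreR Y) (@FSgroup_mulrV _ _ oreR Y).

Section Abelianisation.
Local Open Scope group_scope.
Variable G : groupType.

Inductive commutator_subgroup : G -> Prop :=
| commutator_commg x y : commutator_subgroup [~ x, y]
| commutator_one : commutator_subgroup 1
| commutator_mul x y : commutator_subgroup x -> commutator_subgroup y ->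
    commutator_subgroup (x * y)
| commutator_inv x : commutator_subgroup x -> commutator_subgroup x^-1.

Definition abelianised (x y : G) : bool := `[< commutator_subgroup (x^-1 * y) >].

Lemma commutator_conj x y : commutator_subgroup x -> commutator_subgroup (x ^ y).
Proof.
move=> Hx; rewrite -(mulVKg x (x ^ y)) -commgEl; apply: commutator_mul => //.
exact: commutator_commg.
Qed.

Lemma abelianised_equiv : equiv_class_of abelianised.
Proof.
split=> [x|x y|x y z].
- by apply/asboolP; rewrite mulVg; exact: commutator_one.
- by apply/asboolP/asboolP => /commutator_inv; rewrite invMg invgK.
- move=> /asboolP Hx /asboolP Hz; apply/asboolP.
  by have := commutator_mul Hx Hz; rewrite -mulgA mulVKg.
Qed.

Canonical abelianised_equivRel := EquivRelPack abelianised_equiv.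

Local Open Scope quotient_scope.
Definition abelianisation : Type := {eq_quot abelianised_equivRel}.
HB.instance Definition _ := Choice.on abelianisation.
HB.instance Definition _ := Quotient.on abelianisation.
HB.instance Definition _ : EqQuotient _ abelianised_equivRel abelianisation :=
  EqQuotient.on abelianisation.

Definition to_ab (x : G) : abelianisation := \pi_abelianisation x.

Definition ab_add (x y : abelianisation) : abelianisation := to_ab (repr x * repr y).
Definition ab_opp (x : abelianisation) : abelianisation := to_ab (repr x)^-1.

Lemma abP x y : to_ab x = to_ab y <-> commutator_subgroup (x^-1 * y).
Proof. by split=> [/eqmodP/asboolP|H] //; apply/eqmodP/asboolP. Qed.

Lemma ab_ind (P : abelianisation -> Prop) : (forall x, P (to_ab x)) -> forall x, P x.
Proof. by move=> H x; rewrite -[x]reprK; exact: H. Qed.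

Lemma ab_addE x y : ab_add (to_ab x) (to_ab y) = to_ab (x * y).
Proof.
rewrite /ab_add; have /abP := reprK (to_ab x); have /abP := reprK (to_ab y).
set x' := repr _; set y' := repr _ => Hy Hx; apply/abP.
have -> : (y' * x')^-1 * (x * y) = (y'^-1 * x) ^ x' * (x'^-1 * y).
  by rewrite conjgE invMg !mulgA mulgK.
by apply: commutator_mul => //; exact: commutator_conj.
Qed.

Lemma ab_oppE x : ab_opp (to_ab x) = to_ab x^-1.
Proof.
rewrite /ab_opp; have /abP := reprK (to_ab x); set x' := repr _ => Hx; apply/abP.
have -> : x'^-1^-1 * x^-1 = ((x'^-1 * x)^-1) ^ x'^-1.
  by rewrite conjgE !invMg !invgK -!mulgA mulgV mulg1.
exact/commutator_conj/commutator_inv.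
Qed.

Lemma ab_addA : associative ab_add.
Proof.
elim/ab_ind => x; elim/ab_ind => y; elim/ab_ind => z.
by rewrite !ab_addE mulgA.
Qed.

Lemma ab_addC : commutative ab_add.
Proof.
elim/ab_ind => x; elim/ab_ind => y; rewrite !ab_addE; apply/abP.
rewrite invMg -mulgA; exact: commutator_commg.
Qed.

Lemma ab_add0 : left_id (to_ab 1) ab_add.
Proof. by elim/ab_ind => x; rewrite ab_addE mul1g. Qed.

Lemma ab_addN : left_inverse (to_ab 1) ab_opp ab_add.
Proof. by elim/ab_ind => x; rewrite ab_oppE ab_addE mulVg. Qed.

HB.instance Definition _ := GRing.isZmodule.Build abelianisation
  ab_addA ab_addC ab_add0 ab_addN.

Lemma abM x y : to_ab (x * y) = (to_ab x + to_ab y)%R.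
Proof. by rewrite -ab_addE. Qed.

End Abelianisation.

Section Target.
Import GRing.Theory.
Local Open Scope ring_scope.

Section Span.
Variables (V : zmodType) (X : set V).

Inductive zspanned : V -> Prop :=
| zspanned_gen v : X v -> zspanned v
| zspanned0 : zspanned 0
| zspannedB u v : zspanned u -> zspanned v -> zspanned (u - v).

(* The subgroup of V generated by X. *)
Definition zspan : {pred V} := fun v => `[< zspanned v >].

Lemma zspan_zmod_closed : zmod_closed zspan.
Proof.
split=> [|u v]; first by apply/asboolP; exact: zspanned0.
by move=> /asboolP Hu /asboolP Hv; apply/asboolP; exact: zspannedB.
Qed.

HB.instance Definition _ := GRing.isZmodClosed.Build V zspan zspan_zmod_closed.

End Span.

Definition chi (S : choiceType) (t : tree S) : {freeg S / int} :=
  \sum_(c <- colours t) << c >>.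

Lemma coeff_chi (S : choiceType) (t : tree S) (b : S) :
  coeff b (chi t) = (count_mem b (colours t))%:Z.
Proof.
rewrite /chi raddf_sum /=; elim: (colours t) => [|c s IH]; first by rewrite big_nil.
by rewrite big_cons IH coeffU mul1r /= natz -PoszD.
Qed.

Definition relators (S : choiceType) (R : set (skein S)) (a : S) :
    set {freeg S / int} :=
  [set v | v = << a >> \/ exists2 u, R u & v = chi (lhs u) - chi (rhs u)].

End Target.

Notation colour_quotient R a := {ideal_quot (zspan (relators R a))}.

Definition zmod_isomorphic (U V : zmodType) : Prop :=
  exists phi : {additive U -> V}, bijective phi.

(* Main.v *)
Require Import Defs.
From HB Require Import structures.
From mathcomp Require Import all_boot all_order all_algebra all_fingroup.
From mathcomp Require Import boolp classical_sets freeg ring_quotient generic_quotient.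

(* Connecting every object n to 1 by the right vine of a-coloured carets extends
   the abelianisation map of G^Y to a functor Phi from F^Y to G^Y_ab that vanishes
   on vines. Let x_n be the value of Phi at the rotation of n points. Pushing the
   rotation past a caret shows that moving the caret by one place changes Phi by
   d_n = x_n - x_(n+1). Carets at different places commute, so d_n = 2 d_(n+1) for
   n >= 2 and 2 d_n = 3 d_(n+1) for n >= 3; hence d_n = 0, and x_n = 0 because
   2 x_2 = 3 x_3 = 0. Thus Phi of a c-coloured caret depends only on c, at first for
   forests with at least two roots, then for trees by the Ore condition, and Phi of a
   forest is a sum over its interior vertices.

   For Y = V, a rotation of evenly many points is odd, which kills all permutations
   of evenly many points; pushing a permutation past a caret settles the odd case.

   Therefore [t p, s] has class k(chi(t) - chi(s)) for an additive map k that kills a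
   and the relators, so k inverts the map of the theorem. *)

Set Implicit Arguments.
Unset Strict Implicit.
Unset Printing Implicit Defensive.

Import GRing.Theory.
Local Open Scope ring_scope.
Local Open Scope quotient_scope.

(** * Elementary forests and weighted sums over interior vertices *)

Section Forests.
Variable S : Type.
Implicit Types (t : tree S) (f g : seq (tree S)) (c : S).

Lemma fcomp_id_l n g : size g = n -> fcomp (nseq n Leaf) g = g.
Proof. by move=> <-; elim: g => //= t g IH; rewrite fcomp_cons /= ?take0 drop0 IH. Qed.

Lemma fleaves_id n : fleaves (nseq n (@Leaf S)) = n.
Proof. by rewrite map_nseq sumn_nseq mul1n. Qed.

Lemma fleaves_cat f g : fleaves (f ++ g) = (fleaves f + fleaves g)%N.
Proof. by rewrite map_cat sumn_cat. Qed.

Definition caret c : tree S := Node c Leaf Leaf.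

Definition elementary i c j : seq (tree S) :=
  nseq i Leaf ++ caret c :: nseq j Leaf.

Lemma size_elementary i c j : size (elementary i c j) = (i + j).+1.
Proof. by rewrite size_cat /= !size_nseq addnS. Qed.

Lemma fleaves_elementary i c j : fleaves (elementary i c j) = (i + j).+2.
Proof. by rewrite fleaves_cat /= !fleaves_id !addnS. Qed.

Lemma elementary_catr i c j m :
  elementary i c j ++ nseq m Leaf = elementary i c (j + m).
Proof. by rewrite /elementary nseqD -catA. Qed.

Lemma elementary_catl i c j m :
  nseq m Leaf ++ elementary i c j = elementary (m + i) c j.
Proof. by rewrite /elementary nseqD -catA. Qed.

Lemma fcomp_caret c t1 t2 : fcomp [:: caret c] [:: t1; t2] = [:: Node c t1 t2].
Proof. by []. Qed.

Definition fcolours f : seq S := flatten [seq colours t | t <- f].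

Lemma fcolours1 t : fcolours [:: t] = colours t.
Proof. by rewrite /fcolours /= cats0. Qed.

Lemma fcolours_id n : fcolours (nseq n Leaf) = [::].
Proof. by elim: n. Qed.

Section ColourSum.
Variables (A : zmodType) (y : S -> A).

Definition colour_sum f : A := \sum_(c <- fcolours f) y c.

Lemma colour_sum_cat f g : colour_sum (f ++ g) = colour_sum f + colour_sum g.
Proof. by rewrite /colour_sum /fcolours map_cat flatten_cat big_cat. Qed.

Lemma colour_sum_cons t f : colour_sum (t :: f) = colour_sum [:: t] + colour_sum f.
Proof. exact: (colour_sum_cat [:: t]). Qed.

Lemma colour_sum_nil : colour_sum [::] = 0.
Proof. exact: big_nil. Qed.

Lemma colour_sum_id n : colour_sum (nseq n Leaf) = 0.
Proof. by rewrite /colour_sum fcolours_id big_nil. Qed.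

Lemma colour_sum_node c t1 t2 :
  colour_sum [:: Node c t1 t2] = y c + colour_sum [:: t1; t2].
Proof. by rewrite /colour_sum /fcolours /= !cats0 big_cons. Qed.

Lemma colour_sum_graft t g : size g = nleaves t ->
  colour_sum [:: graft t g] = colour_sum [:: t] + colour_sum g.
Proof.
elim: t g => [|c t1 IH1 t2 IH2] g /=.
  by case: g => [|u []] //= _; rewrite (colour_sum_id 1) add0r.
move=> sg; rewrite !colour_sum_node colour_sum_cons IH1 ?IH2.
- rewrite addrACA -(colour_sum_cat (take _ _)) cat_take_drop.
  by rewrite (colour_sum_cons t1 [:: t2]) -!addrA.
- by rewrite size_drop sg addKn.
by rewrite size_takel // sg leq_addr.
Qed.

Lemma colour_sum_comp f g : size g = fleaves f ->
  colour_sum (fcomp f g) = colour_sum f + colour_sum g.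
Proof.
elim: f g => [|t f IH] g /= sg.
  by case: g sg => //; rewrite colour_sum_nil addr0.
rewrite fcomp_cons colour_sum_cons colour_sum_graft ?IH.
- by rewrite addrACA -(colour_sum_cat (take _ _)) cat_take_drop (colour_sum_cons t f).
- by rewrite size_drop sg addKn.
by rewrite size_takel // sg leq_addr.
Qed.

(** Both [fcomp] and concatenation add colour sums, so equality on [R] passes to the generated
    congruence. *)
Lemma colour_sum_skein (R : set (skein S)) f g :
  (forall u, R u -> colour_sum [:: lhs u] = colour_sum [:: rhs u]) ->
  skein_eq R f g -> colour_sum f = colour_sum g.
Proof.
move=> yR; elim=> {f g} //=.
- by move=> f g h _ -> _ ->.
- by move=> f f' g g' sg sg' _ Ef _ Eg; rewrite !colour_sum_comp ?Ef ?Eg.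
- by move=> f f' g g' _ Ef _ Eg; rewrite !colour_sum_cat Ef Eg.
Qed.

Lemma colour_sum_permseq n (s : 'S_n) f : size f = n ->
  colour_sum (permseq Leaf s f) = colour_sum f.
Proof.
have sumE g : colour_sum g = \sum_(t <- g) colour_sum [:: t].
  elim: g => [|t g IH]; first by rewrite big_nil colour_sum_nil.
  by rewrite big_cons colour_sum_cons IH.
move=> sf; rewrite !sumE big_map big_enum /= (big_nth Leaf) big_mkord sf.
by rewrite (reindex_inj (@perm_inj _ s)); apply: eq_bigr => i _; rewrite permK.
Qed.

End ColourSum.
End Forests.

(** * Additive functions on forests are colour sums *)

(* The function [phi] stands for a functor from the forests with permutations to an
   abelian group, and [X n] for its value at the inverse of the rotation of n points. *)
Section ColourCount.
Variables (S : Type) (A : zmodType) (phi : seq (tree S) -> A) (X : nat -> A) (a : S).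
Hypothesis phi_comp : forall f g, (0 < size f)%N -> size g = fleaves f ->
  phi (fcomp f g) = phi f + phi g.
Hypothesis phi_rot : forall t f, X (size f).+1 + phi (t :: f) =
  phi (rcons f t) + X (fleaves (t :: f)) *+ nleaves t.
Hypothesis X_torsion : forall n, X n *+ n = 0.
Hypothesis phi_vine : forall n, phi (elementary n a 0) = 0.

Let I n : seq (tree S) := nseq n Leaf.

(** Interchange law: here [f] is grown first and then [g]; [phi_tensorr] uses the other order. *)
Lemma phi_tensorl f g : (0 < size f + size g)%N ->
  phi (f ++ g) = phi (f ++ I (size g)) + phi (I (fleaves f) ++ g).
Proof.
move=> s0; rewrite -phi_comp ?size_cat ?size_nseq //.
  by rewrite fcomp_cat ?size_nseq // fcomp_id fcomp_id_l.
by rewrite fleaves_cat fleaves_id.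
Qed.

Lemma phi_tensorr f g : (0 < size f + size g)%N ->
  phi (f ++ g) = phi (I (size f) ++ g) + phi (f ++ I (fleaves g)).
Proof.
move=> s0; rewrite -phi_comp ?size_cat ?size_nseq //.
  by rewrite fcomp_cat ?fleaves_id // fcomp_id fcomp_id_l.
by rewrite fleaves_cat fleaves_id.
Qed.

Let y i c j := phi (elementary i c j).
Let d n := X n - X n.+1.

(** Carets at distinct places commute; growing the left one first shifts the right one by one
    place. *)
Lemma interchange i c k e j :
  y i c (k + j.+1) + y (i + k).+2 e j = y (i + k).+1 e j + y i c (k + j.+2).
Proof.
have s0 : (0 < size (elementary i c k) + size (elementary 0 e j))%N.
  by rewrite size_elementary.
have := phi_tensorl s0; rewrite (phi_tensorr s0) !size_elementary !fleaves_elementary !add0n.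
rewrite !elementary_catr !elementary_catl !addn0 => /esym; apply.
Qed.

Lemma elementary_shift i c j : y i c j = y (i + j) c 0 + d (i + j).+1 *+ j.
Proof.
elim: j i => [|j IH] i; first by rewrite addn0 addr0.
suff -> : y i c j.+1 = y i.+1 c j + d (i + j).+2.
  by rewrite IH addSn addnS -addrA -mulrSr.
(* Rotating a leading leaf to the end moves the caret one place to the left. *)
have := phi_rot Leaf (elementary i c j).
rewrite -cats1 -[[:: Leaf]]/(I 1) -[Leaf :: _]/(I 1 ++ _).
rewrite elementary_catr elementary_catl fleaves_elementary size_elementary.
rewrite add1n addn1 addSn mulr1n -/(y _ _ _) -/(y _ _ _) => E.
by apply: (addIr (X (i + j).+3)); rewrite -E addrC -addrA subrK.
Qed.

Lemma d_eq0 n : d n.+2 = 0.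
Proof.
have ya i k : y i a k = d (i + k).+1 *+ k.
  by rewrite elementary_shift /y phi_vine add0r.
(* Two [a]-carets are interchanged, the right one in last place, where [phi_vine] kills it. *)
have E i k : d (i + k).+2 *+ k.+1 = d (i + k).+3 *+ k.+2.
  have := interchange i a k a 0; rewrite !ya !mulr0n addr0 add0r.
  by rewrite !addn1 !addn2 !addnS.
have E1 m : d m.+2 = d m.+3 *+ 2 by have := E m 0; rewrite addn0.
have E2 m : d m.+4 = 0.
  (* Substituting [E1] leaves four times [d m.+4] equal to three times it. *)
  have := E m 1; rewrite addn1 E1 -mulrnA => /eqP.
  by rewrite (mulrSr _ 3) -subr_eq0 addrC addKr => /eqP.
by case: n => [|[|n]]; [rewrite E1 (E1 1) E2 !mul0rn|rewrite E1 E2 mul0rn|exact: E2].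
Qed.

Lemma X_eq0 n : X n.+1 = 0.
Proof.
have X2 m : X m.+2 = X 2.
  by elim: m => // m <-; apply/esym/eqP; rewrite -subr_eq0; apply/eqP/d_eq0.
(* Index 1 is below the range of [d_eq0], but there the torsion relation itself says [X 1 = 0]. *)
suff X20 : X 2 = 0 by case: n => [|n]; rewrite ?X2 // -[LHS]mulr1n X_torsion.
by have := X_torsion 3; rewrite X2 mulrSr X_torsion add0r.
Qed.

(** A leaf stands beside the caret because independence of place is first obtained with two roots;
    the last place makes the weight of [a] vanish. *)
Definition weight c : A := phi (elementary 1 c 0).
Notation W := (colour_sum weight).

(** For a fixed number of roots [d_eq0] removes the shift; commuting with an [a]-caret in last
    place, of value 0, changes that number. *)
Lemma elementary_weight i c j : (0 < i + j)%N -> y i c j = weight c.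
Proof.
move=> ij; rewrite elementary_shift; case E : (i + j)%N ij => [|n] // _.
rewrite d_eq0 mul0rn addr0; elim: n {i j E} => // n <-.
have := interchange 0 c n a 0; rewrite ![y _ a _]phi_vine addr0 !add0r.
by rewrite addn1 addn2 !(elementary_shift 0) !add0n !d_eq0 !mul0rn !addr0 => ->.
Qed.

Lemma weight_vine : weight a = 0.
Proof. exact: phi_vine. Qed.

Lemma phi_id n : phi (I n.+1) = 0.
Proof.
have := @phi_comp (I n.+1) (I n.+1) isT; rewrite fcomp_id_l ?size_nseq //.
rewrite fleaves_id => /(_ erefl)/eqP.
by rewrite -subr_eq0 opprD addrA subrr sub0r oppr_eq0 => /eqP.
Qed.

(** The root is a caret among at least two roots, and its two subtrees stand side by side, so each
    again has a neighbour. *)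
Lemma phi_tree t i j : (0 < i + j)%N -> phi (I i ++ t :: I j) = W [:: t].
Proof.
elim: t i j => [|c t1 IH1 t2 IH2] i j ij.
  rewrite (colour_sum_id _ 1) -[_ :: _]/(I j.+1) -nseqD addnS; exact: phi_id.
have -> : I i ++ Node c t1 t2 :: I j =
    fcomp (elementary i c j) (I i ++ [:: t1; t2] ++ I j).
  rewrite fcomp_cat ?size_nseq ?fleaves_id // fcomp_id_l ?size_nseq //.
  by rewrite -[caret c :: _]cat1s fcomp_cat // fcomp_caret fcomp_id_l ?size_nseq.
rewrite phi_comp ?size_elementary //; last first.
  by rewrite fleaves_elementary !size_cat !size_nseq /= !addnS.
rewrite -/(y _ _ _) elementary_weight // colour_sum_node colour_sum_cons.
have -> : I i ++ [:: t1; t2] ++ I j = (I i ++ [:: t1]) ++ t2 :: I j by rewrite -catA.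
rewrite phi_tensorl ?size_cat ?size_nseq //=; last by rewrite addnS.
rewrite -catA size_nseq (IH1 i j.+1) ?addnS // IH2 // fleaves_cat fleaves_id /= addn0.
by rewrite addn_gt0 addn_gt0 nleaves_gt0 orbT.
Qed.

(** Trees are grown from left to right. Each one grown leaves only its leaves on the left, so [i]
    varies in the induction. *)
Lemma phi_many i f : (1 < i + size f)%N -> phi (I i ++ f) = W f.
Proof.
elim: f i => [|t f IH] i.
  rewrite addn0 cats0 => i1; rewrite colour_sum_nil.
  by case: i i1 => // i _; exact: phi_id.
rewrite /= addnS ltnS => i_f.
have -> : I i ++ t :: f = (I i ++ [:: t]) ++ f by rewrite -catA.
rewrite phi_tensorl ?size_cat ?addn1 // fleaves_cat fleaves_id /= addn0 -catA.
rewrite (phi_tree t i_f) (colour_sum_cons _ t f).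
have [->|f0] := eqVneq f [::]; last first.
  congr (_ + _); apply: IH; rewrite -(addn1 1) leq_add ?addn_gt0 ?nleaves_gt0 ?orbT //.
  by rewrite lt0n size_eq0.
rewrite cats0 colour_sum_nil; congr (_ + _).
by case: (nleaves t) (nleaves_gt0 t) => // n _; rewrite addnS phi_id.
Qed.

Hypothesis phi_ore : forall c, exists f g, [/\ size f = 2%N, size g = 2%N &
  forall j, phi (fcomp [:: caret c] f ++ I j) = phi (fcomp [:: caret a] g ++ I j)].

(* With a single root, the rotation relations are void; comparing a common right
   multiple of the two carets with its stabilisation closes this gap. *)
Lemma phi_caret c : phi [:: caret c] = weight c.
Proof.
have [f [g [sf sg E]]] := phi_ore c.
have := E 0; rewrite !cats0 !phi_comp //; have := E 1.
have E1 e h : size h = 2%N -> phi (fcomp [:: caret e] h ++ I 1) = weight e + W h.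
  move=> sh; have := @phi_many 0 (fcomp [:: caret e] h ++ I 1).
  rewrite size_cat size_fcomp => -> //.
  rewrite colour_sum_cat colour_sum_id colour_sum_comp // colour_sum_node.
  by rewrite (colour_sum_id _ 2) !addr0.
rewrite !E1 // weight_vine add0r => Eg.
rewrite (@phi_many 0 f) ?sf // (@phi_many 0 g) ?sg // -Eg.
by rewrite [phi [:: caret a]](phi_vine 0) add0r => /addIr.
Qed.

Lemma phi_colour_sum f : (0 < size f)%N -> phi f = W f.
Proof.
case: f => [|[|c t1 t2] [|u f]] // _; last 2 first.
- rewrite -fcomp_caret phi_comp // phi_caret.
  by rewrite (@phi_many 0 [:: t1; t2]) // colour_sum_node.
- exact: (@phi_many 0 [:: Node _ _ _, u & f]).
- by rewrite (colour_sum_id _ 1) (phi_id 0).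
exact: (@phi_many 0 [:: Leaf, u & f]).
Qed.

End ColourCount.

(** * Rotations and additive functions on symmetric groups *)

Lemma porbit_rotation n (i : 'I_n) : porbit (rotation n) i = [set: 'I_n].
Proof.
(* From [i], [n - i] steps lead round to 0 and [j] more to [j]; no subtraction is truncated. *)
apply/setP => j; rewrite inE; apply/porbitP; exists (n - i + j)%N.
apply: val_inj; rewrite permX.
have -> k : val (iter k (rotation n) i) = ((i + k) %% n)%N.
  elim: k => [|k IH]; first by rewrite addn0 modn_small.
  by rewrite iterS permE /= IH -addn1 modnDml addn1 addnS.
by rewrite addnA subnKC ?(ltnW (ltn_ord i)) // modnDl modn_small.
Qed.

(** The parity of a permutation is that of [n] plus its number of orbits, here one. *)
Lemma odd_rotation n : (0 < n)%N -> odd_perm (rotation n) = ~~ odd n.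
Proof.
move=> n0; rewrite /odd_perm card_ord.
suff -> : porbits (rotation n) = [set [set: 'I_n]] by rewrite cards1 addbT.
apply/setP => B; rewrite inE; apply/imsetP/eqP => [[i _ ->]|->].
  exact: porbit_rotation.
by exists (Ordinal n0); rewrite ?porbit_rotation.
Qed.

Lemma permseq_rotationVX n j (T : Type) (x0 : T) (v : seq T) : (j <= n)%N ->
  size v = n -> permseq x0 ((rotation n)^-1 ^+ j)%g v = rot j v.
Proof.
move=> + sv; elim: j => [|j IH] ltj; first by rewrite rot0 permseq1.
rewrite expgSr permseqM IH 1?ltnW // permseq_rotationV ?size_rot //.
by rewrite -rotS ?sv.
Qed.

Lemma rotationV_expn n : ((rotation n)^-1 ^+ n = 1)%g.
Proof.
apply: eq_perm_permseq => v sv.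
by rewrite permseq_rotationVX // -[X in rot X]sv rot_size permseq1.
Qed.

Lemma rotationV_Sigma Y n : ((rotation n)^-1)%g \in Sigma Y n.
Proof. by case: Y; rewrite /= ?inE // groupV cycle_id. Qed.

Lemma Sigma_T n (s : 'S_n) : s \in Sigma KindT n ->
  exists k, s = ((rotation n)^-1 ^+ k)%g.
Proof. by rewrite /= -cycleV => /cycleP. Qed.

Section PermutationCharacter.
Variables (n : nat) (A : zmodType) (h : 'S_n -> A).
Hypothesis hM : forall s t, h (s * t)%g = h s + h t.

Lemma perm_char1 : h 1%g = 0.
Proof. by apply: (addrI (h 1%g)); rewrite -hM mulg1 addr0. Qed.

Lemma perm_charJ s t : h (s ^ t)%g = h s.
Proof.
by rewrite conjgE !hM addrCA -hM mulVg perm_char1 addr0.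
Qed.

(** Transpositions are conjugate: the first factor of [u] carries [x] to [z], the second moves the
    image of [y] to [t] and fixes [z]. *)
Lemma perm_char_tperm (x y z t : 'I_n) : x != y -> z != t ->
  h (tperm x y) = h (tperm z t).
Proof.
move=> xy zt; pose u := (tperm x z * tperm (tperm x z y) t)%g.
have ux : u x = z.
  rewrite permM tpermL tpermD // 1?eq_sym //.
  by rewrite -[X in X != _](tpermL x z) (inj_eq perm_inj).
have uy : u y = t by rewrite permM tpermL.
by rewrite -ux -uy -tpermJ perm_charJ.
Qed.

(** Transpositions share one value, killed by 2. As [r] is a product of an odd number of them, this
    value is [h r = 0]. *)
Lemma perm_char_eq0 (r : 'S_n) : odd_perm r -> h r = 0 -> forall s, h s = 0.
Proof.
move=> odd_r hr; have h2 x y : h (tperm x y) *+ 2 = 0.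
  by rewrite mulr2n -hM tperm2 perm_char1.
have h_prod x y (ts : seq ('I_n * 'I_n)) : x != y -> all dpair ts ->
    h (\prod_(t <- ts) tperm t.1 t.2)%g = h (tperm x y) *+ size ts.
  move=> xy; elim: ts => [|t ts IH] /=; first by rewrite big_nil perm_char1.
  case/andP=> dt dts; rewrite big_cons hM IH // mulrS; congr (_ + _).
  exact: perm_char_tperm.
have h0 x y : x != y -> h (tperm x y) = 0.
  move=> xy; have [ts Er dts] := prod_tpermP r.
  move: odd_r hr; rewrite Er odd_perm_prod // (h_prod x y) // => odd_ts.
  by rewrite -(odd_double_half (size ts)) odd_ts -muln2 mulnC mulrnDr mulrnA h2
    mul0rn addr0.
move=> s; have [[|[x y] ts] -> dts] := prod_tpermP s.
  by rewrite big_nil perm_char1.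
by have /andP[xy _] := dts; rewrite (h_prod x y) // h0 ?mul0rn.
Qed.

End PermutationCharacter.

(** * Vines and the functor they define *)

Section Vines.
Variables (S : Type) (a : S).

Fixpoint vine n : tree S := if n is m.+1 then Node a Leaf (vine m) else Leaf.

Lemma nleaves_vine n : nleaves (vine n) = n.+1.
Proof. by elim: n => //= n ->. Qed.

Lemma graft_vine n : graft (vine n) (elementary n a 0) = vine n.+1.
Proof. by elim: n => //= n <-; rewrite drop0. Qed.

End Vines.

Section ForestFunctor.
Variables (S : Type) (R : set (skein S)) (oreR : Ore R) (Y : kind) (a : S).
Notation FSY := (FSY R Y).
Notation G := (FSgroup oreR Y).
Notation A := (abelianisation G).
Notation frac := (FSfrac oreR).
Notation cls := (\pi_(FS R _ _)).

Lemma FS_comp_id_l l r (f : FS R l r) (r0 : (0 < r)%N) : FS_comp (FS_id R r0) f = f.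
Proof.
elim/FS_ind: f => f; rewrite FS_compE; congr (cls _); apply: val_inj => /=.
by rewrite fcomp_id_l // size_forest.
Qed.

Lemma FS_block1 l r (f : FS R l r) : FS_block 1%g f = 1%g.
Proof.
have := FS_blockM 1%g 1%g f; rewrite FS_perm1 mulg1 => E.
by apply: (mulgI (FS_block 1%g f)); rewrite -E mulg1.
Qed.

Lemma FSY_comp_id_l l r (x : FSY l r) (r0 : (0 < r)%N) :
  FSY_comp (FSY_id R Y r0) x = x.
Proof.
by apply: FSY_eq; rewrite /= ?FS_perm1 ?FS_comp_id_l // FS_block1 mulg1.
Qed.

Lemma vineY_subproof n : (0 < n)%N -> nleaves (vine a n.-1) = n.
Proof. by move=> n0; rewrite nleaves_vine prednK. Qed.

Definition vineY n (n0 : (0 < n)%N) : FSY n 1 :=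
  (FS_tree R (vineY_subproof n0), 1%g).

Lemma frac_add l (x y z : FSY l 1) :
  to_ab (frac x y) + to_ab (frac y z) = to_ab (frac x z).
Proof. by rewrite -abM -(FSgroup_mulE oreR x y z). Qed.

(* A functor from F^Y to the abelianised group: the vines connect every object to 1. *)
Definition FSY_char l r (x : FSY l r) : A :=
  to_ab (frac (FSY_comp (vineY (FS_gt0 x.1)) x) (vineY (FS_leaves_gt0 x.1))).

Lemma FSY_charE l r (r0 : (0 < r)%N) (l0 : (0 < l)%N) (x : FSY l r) :
  FSY_char x = to_ab (frac (FSY_comp (vineY r0) x) (vineY l0)).
Proof.
rewrite /FSY_char (bool_irrelevance r0 (FS_gt0 x.1)).
by rewrite (bool_irrelevance l0 (FS_leaves_gt0 x.1)).
Qed.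

Lemma FSY_char_comp l m r (x : FSY m r) (y : FSY l m) :
  FSY_char (FSY_comp x y) = FSY_char x + FSY_char y.
Proof.
have r0 := FS_gt0 x.1; have m0 := FS_gt0 y.1; have l0 := FS_leaves_gt0 y.1.
rewrite (FSY_charE r0 l0) (FSY_charE r0 m0 x) (FSY_charE m0 l0 y) -FSY_compA.
(* Expanding the fraction of [x] by [y] makes it end where the fraction of [y] begins. *)
by rewrite -(FSfrac_comp oreR _ (vineY m0) y) frac_add.
Qed.

Lemma vineY1 : vineY (ltn0Sn 0) = FSY_id R Y (ltn0Sn 0).
Proof. by apply: FSY_eq => //=; congr (cls _); apply: val_inj. Qed.

(** The vine at 1 is the identity, so each value is a fraction over the same vine, which cancels in
    the difference. *)
Lemma to_ab_frac l (x y : FSY l 1) : to_ab (frac x y) = FSY_char x - FSY_char y.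
Proof.
have l0 := FS_leaves_gt0 x.1; rewrite !(FSY_charE (ltn0Sn 0) l0).
by rewrite vineY1 !FSY_comp_id_l -(frac_add x y (vineY l0)) addrK.
Qed.

Lemma FSY_char_vine n (n0 : (0 < n)%N) : FSY_char (vineY n0) = 0.
Proof.
rewrite (FSY_charE (ltn0Sn 0) n0) -(subrr (FSY_char (vineY n0))) -to_ab_frac.
by rewrite vineY1 FSY_comp_id_l.
Qed.

Definition pure l r (f : FS R l r) : FSY l r := (f, 1%g).

(** [subg] recovers [s] only inside [Sigma Y n], hence the membership hypotheses below. *)
Definition permY n (n0 : (0 < n)%N) (s : 'S_n) : FSY n n :=
  (FS_id R n0, subg (Sigma Y n) s).

Lemma pure_comp l m r (f : FS R m r) (g : FS R l m) :
  FSY_comp (pure f) (pure g) = pure (FS_comp f g).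
Proof. by apply: FSY_eq; rewrite /= ?FS_perm1 // FS_block1 mulg1. Qed.

Lemma pure_permY l r (x : FSY l r) (l0 : (0 < l)%N) :
  x = FSY_comp (pure x.1) (permY l0 (sgval x.2)).
Proof.
apply: FSY_eq; rewrite /= ?FS_perm1 ?FS_comp_id // FS_block_id mulg1 subgK //.
exact: subgP.
Qed.

(** The exchange rule [s f = f^s s^f], from which the relations between rotations and carets
    come. *)
Lemma permY_pure l r (f : FS R l r) (r0 : (0 < r)%N) (l0 : (0 < l)%N) s :
  s \in Sigma Y r ->
  FSY_comp (permY r0 s) (pure f) =
  FSY_comp (pure (FS_perm s f)) (permY l0 (FS_block s f)).
Proof.
move=> Ys; apply: FSY_eq => /=.
  by rewrite FS_comp_id_l FS_perm1 FS_comp_id subgK.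
by rewrite FS_block_id mulg1 mul1g !subgK // FS_block_Sigma.
Qed.

Lemma permYM n (n0 : (0 < n)%N) s t : s \in Sigma Y n -> t \in Sigma Y n ->
  permY n0 (s * t)%g = FSY_comp (permY n0 t) (permY n0 s).
Proof.
move=> Ys Yt; apply: FSY_eq => /=; first by rewrite FS_perm_id FS_comp_id.
by rewrite FS_block_id !subgK // groupM.
Qed.

Lemma FSY_char_permM n (n0 : (0 < n)%N) s t : s \in Sigma Y n -> t \in Sigma Y n ->
  FSY_char (permY n0 (s * t)%g) = FSY_char (permY n0 s) + FSY_char (permY n0 t).
Proof. by move=> Ys Yt; rewrite permYM // FSY_char_comp addrC. Qed.

Lemma FSY_char_permX n (n0 : (0 < n)%N) s k : s \in Sigma Y n ->
  FSY_char (permY n0 (s ^+ k)%g) = FSY_char (permY n0 s) *+ k.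
Proof.
move=> Ys; elim: k => [|k IH]; last first.
  by rewrite expgS mulrS FSY_char_permM ?groupX // IH.
apply: (addrI (FSY_char (permY n0 s))); rewrite addr0 -FSY_char_permM // ?group1 //.
by rewrite expg0 mulg1.
Qed.

Lemma FSY_char_perm l r (f : FS R l r) (r0 : (0 < r)%N) (l0 : (0 < l)%N) s :
  s \in Sigma Y r ->
  FSY_char (permY r0 s) + FSY_char (pure f) =
  FSY_char (pure (FS_perm s f)) + FSY_char (permY l0 (FS_block s f)).
Proof. by move=> Ys; rewrite -!FSY_char_comp (permY_pure f r0 l0). Qed.

Definition rotation_char n : A :=
  if n is m.+1 then FSY_char (permY (ltn0Sn m) (rotation m.+1)^-1%g) else 0.

Lemma rotation_charE n (n0 : (0 < n)%N) :
  rotation_char n = FSY_char (permY n0 (rotation n)^-1%g).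
Proof. by case: n n0 => // n n0; rewrite /rotation_char (bool_irrelevance (ltn0Sn n) n0). Qed.

Lemma rotation_char_torsion n : rotation_char n *+ n = 0.
Proof.
case: n => // n; rewrite -FSY_char_permX ?rotationV_Sigma // rotationV_expn.
have := FSY_char_permX (ltn0Sn n) 0 (rotationV_Sigma Y n.+1).
by rewrite expg0 mulr0n.
Qed.

(** Moving the first tree to the end rotates the leaves by its whole block. *)
Lemma rotation_block l n (F : forest S l n) t (g : seq (tree S)) :
  F = t :: g :> seq _ ->
  FS_block (rotation n)^-1%g (cls F) = ((rotation l)^-1 ^+ nleaves t)%g.
Proof.
move=> EF; have El := fleaves_forest F; rewrite EF /= in El.
have tl : (nleaves t <= l)%N by rewrite -El leq_addr.
rewrite FS_blockE; apply: eq_perm_permseq => v sv.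
rewrite permseq_rotationVX // permseq_blockperm // permseq_rotationV; last first.
  by rewrite size_reshape size_shape.
rewrite EF /= /rot /= drop0 flatten_cat /= take0 cats0 reshapeKr //.
by rewrite size_drop sv -El addKn.
Qed.

(** Bare lists avoid transport between equal objects; only the empty list, which is no forest, gets
    the default 0. *)
Definition forest_char (f : seq (tree S)) : A :=
  oapp (fun F : forest S (fleaves f) (size f) => FSY_char (pure (cls F))) 0 (insub f).

Lemma forest_charE l r (F : forest S l r) : forest_char F = FSY_char (pure (cls F)).
Proof.
case: F => f; move=> fP; have /and3P[_ /eqP sf /eqP lf] := fP.
move: fP; subst l r => fP; rewrite /forest_char /= insubT /=.
by congr (FSY_char (pure (cls _))); apply: val_inj.
Qed.

Lemma forest_of_subproof (f : seq (tree S)) : (0 < size f)%N ->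
  [&& (0 < size f)%N, size f == size f & fleaves f == fleaves f].
Proof. by move->; rewrite !eqxx. Qed.

Lemma forest_char_skein f g : skein_eq R f g -> forest_char f = forest_char g.
Proof.
move=> E; have [|f0] := posnP (size f).
  move=> /[dup] sf; rewrite (skein_eq_size E) => /size0nil ->.
  by move/size0nil: sf => ->.
have fP := forest_of_subproof f0.
have gP : [&& (0 < size f)%N, size g == size f & fleaves g == fleaves f].
  by rewrite f0 -(skein_eq_size E) -(skein_eq_shape E) !eqxx.
rewrite -[f]/(fseq (Forest fP)) -[g]/(fseq (Forest gP)) !forest_charE.
by congr (FSY_char (pure _)); apply/FS_eqP.
Qed.

Lemma forest_char_comp f g : (0 < size f)%N -> size g = fleaves f ->
  forest_char (fcomp f g) = forest_char f + forest_char g.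
Proof.
move=> f0 sg; have fP := forest_of_subproof f0.
have gP : [&& (0 < fleaves f)%N, size g == fleaves f & fleaves g == fleaves g].
  rewrite sg !eqxx !andbT; exact: FS_leaves_gt0 (cls (Forest fP)).
rewrite -[fcomp f g]/(fseq (forest_comp (Forest fP) (Forest gP))).
rewrite -[forest_char f]/(forest_char (Forest fP)) -[forest_char g]/(forest_char (Forest gP)).
rewrite !forest_charE.
by rewrite -FS_compE -pure_comp FSY_char_comp.
Qed.

Lemma forest_char_rot t f : rotation_char (size f).+1 + forest_char (t :: f) =
  forest_char (rcons f t) + rotation_char (fleaves (t :: f)) *+ nleaves t.
Proof.
set F := Forest (@forest_of_subproof (t :: f) isT).
have l0 := FS_leaves_gt0 (cls F); have n0 := ltn0Sn (size f).
rewrite (rotation_charE n0) (rotation_charE l0) -FSY_char_permX ?rotationV_Sigma //.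
rewrite -[forest_char (t :: f)]/(forest_char F) forest_charE.
rewrite (FSY_char_perm (cls F) n0 l0) ?rotationV_Sigma //.
rewrite (@rotation_block _ _ F t f) // FS_permE -forest_charE; congr (forest_char _ + _).
by rewrite /= permseq_rotationV //= /rot /= drop0 take0 cats1.
Qed.

(** Glued to a vine, this forest gives the next vine, and the functor vanishes on both. *)
Lemma forest_char_vine n : forest_char (elementary n a 0) = 0.
Proof.
have n0 := ltn0Sn n; have n1 := ltn0Sn n.+1.
have eP : [&& (0 < n.+1)%N, size (elementary n a 0) == n.+1
    & fleaves (elementary n a 0) == n.+2].
  by rewrite size_elementary fleaves_elementary addn0 !eqxx.
rewrite -[elementary _ _ _]/(fseq (Forest eP)) forest_charE.
have := FSY_char_comp (vineY n0) (pure (cls (Forest eP))).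
rewrite FSY_char_vine add0r => <-; rewrite -(FSY_char_vine n1); congr FSY_char.
rewrite -[vineY n0]/(pure _) pure_comp; congr pure.
rewrite FS_compE; congr (cls _); apply: val_inj => /=.
by rewrite fcomp1 ?graft_vine ?nleaves_vine ?size_elementary ?addn0.
Qed.

(** A common right multiple of the two carets; the congruence respects concatenation, so leaves may
    be added. *)
Lemma forest_char_ore c : exists f g, [/\ size f = 2%N, size g = 2%N &
  forall j, forest_char (fcomp [:: caret c] f ++ nseq j Leaf) =
            forest_char (fcomp [:: caret a] g ++ nseq j Leaf)].
Proof.
have [l [h [k]]] := oreR.2 _ _ _ (@FS_tree S R 2 (caret c) erefl)
  (@FS_tree S R 2 (caret a) erefl).
elim/FS_ind: h => f; elim/FS_ind: k => g.
rewrite !FS_compE => /FS_eqP E; exists f, g; rewrite !size_forest; split=> // j.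
by apply/forest_char_skein/skein_tensor; [exact: E|exact: skein_refl].
Qed.

Definition caret_char (c : S) : A := weight forest_char c.

Lemma forest_char_colour_sum f : (0 < size f)%N ->
  forest_char f = colour_sum caret_char f.
Proof.
exact: phi_colour_sum forest_char_comp forest_char_rot forest_char_vine
  forest_char_ore f.
Qed.

Lemma FSY_char_rotation n (n0 : (0 < n)%N) : FSY_char (permY n0 (rotation n)^-1%g) = 0.
Proof.
rewrite -rotation_charE; case: n n0 => // n _.
exact: X_eq0 forest_char_comp forest_char_rot rotation_char_torsion forest_char_vine n.
Qed.

Lemma FSY_char_pure l r (F : forest S l r) :
  FSY_char (pure (cls F)) = colour_sum caret_char F.
Proof. by rewrite -forest_charE forest_char_colour_sum // size_forest (forest_gt0 F). Qed.

End ForestFunctor.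

(** * The functor vanishes on permutations *)

Section PermutationsVanish.
Variables (S : Type) (R : set (skein S)) (a : S).

Lemma FSY_char_pure_perm (oreR : Ore R) Y l r (s : 'S_r) (f : FS R l r) :
  FSY_char oreR a (pure Y (FS_perm s f)) = FSY_char oreR a (pure Y f).
Proof.
elim/FS_ind: f => F; rewrite FS_permE !FSY_char_pure colour_sum_permseq //.
exact: size_forest.
Qed.

Lemma FSY_char_permY (oreR : Ore R) Y n (n0 : (0 < n)%N) s : s \in Sigma Y n ->
  FSY_char oreR a (permY R Y n0 s) = 0.
Proof.
case: Y => [/Sigma_T[k ->]|_].
  by rewrite FSY_char_permX ?rotationV_Sigma // FSY_char_rotation mul0rn.
have SV m (t : 'S_m) : t \in Sigma KindV m by rewrite inE.
have even_case m (m0 : (0 < m)%N) t : ~~ odd m -> FSY_char oreR a (permY R KindV m0 t) = 0.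
  move=> odd_m; pose h t := FSY_char oreR a (permY R KindV m0 t).
  apply: (@perm_char_eq0 _ _ h _ (rotation m)^-1%g) => [u v||].
  - exact: FSY_char_permM.
  - by rewrite odd_permV odd_rotation.
  exact: FSY_char_rotation.
have [odd_n|] := boolP (odd n); last exact: even_case.
(* This forest has [n] roots and [n + 1] leaves, so the block permutation of [s] falls under the
   even case. *)
have eP : [&& (0 < n)%N, size (elementary n.-1 a 0) == n
    & fleaves (elementary n.-1 a 0) == n.+1].
  by rewrite size_elementary fleaves_elementary addn0 prednK // !eqxx n0.
have := FSY_char_perm oreR a (\pi_(FS R _ _) (Forest eP)) n0 (ltn0Sn n) (SV _ s).
by rewrite FSY_char_pure_perm (even_case n.+1) ?addr0 /= ?odd_n // -[RHS]add0r => /addIr.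
Qed.

Lemma to_ab_frac_pure (oreR : Ore R) Y l (x y : FSY R Y l 1) :
  to_ab (FSfrac oreR x y) = FSY_char oreR a (pure Y x.1) - FSY_char oreR a (pure Y y.1).
Proof.
have l0 := FS_leaves_gt0 x.1.
rewrite (to_ab_frac oreR a) [in LHS](pure_permY x l0) [in LHS](pure_permY y l0) !FSY_char_comp.
by rewrite !FSY_char_permY ?subgP // !addr0.
Qed.

End PermutationsVanish.


(** * Universal properties and induced homomorphisms *)

Lemma inj_surj_bijective (T T' : Type) (f : T -> T') :
  injective f -> (forall y, exists x, f x = y) -> bijective f.
Proof.
move=> f_inj /choice[g gK]; exists g => // x; exact/f_inj/gK.
Qed.

(** A homomorphism to an abelian group kills commutators, so its value at a representative is well
    defined. *)
Lemma ab_lift (G : groupType) (A : zmodType) (h : G -> A) :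
  {morph h : x y / (x * y)%g >-> x + y} ->
  exists phi : {additive abelianisation G -> A}, forall x, phi (to_ab x) = h x.
Proof.
move=> hM; have h1 : h 1%g = 0 by apply: (addrI (h 1%g)); rewrite -hM mulg1 addr0.
have hV x : h x^-1%g = - h x by apply/eqP; rewrite -addr_eq0 -hM mulVg h1.
have h_comm x : commutator_subgroup x -> h x = 0.
  elim=> {x} [x y||x y _ hx _ hy|x _ hx] //.
  - by rewrite commgEl conjgE !hM !hV (addrCA (- h y)) addNr addr0 addNr.
  - by rewrite hM hx hy addr0.
  by rewrite hV hx oppr0.
pose phi (u : abelianisation G) : A := h (repr u).
have phiE x : phi (to_ab x) = h x.
  have /abP/h_comm := reprK (to_ab x).
  by rewrite hM hV addrC => /eqP; rewrite subr_eq0 => /eqP.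
have phiB : zmod_morphism phi.
  elim/ab_ind => x; elim/ab_ind => y.
  have -> : to_ab x - to_ab y = to_ab (x * y^-1)%g by rewrite abM -ab_oppE.
  by rewrite !phiE hM hV.
pose pm := GRing.isZmodMorphism.Build _ _ phi phiB.
pose additive_phi : {additive _ -> _} := HB.pack phi pm.
by exists additive_phi.
Qed.

Section GroupCharacter.
Variables (S : Type) (R : set (skein S)) (oreR : Ore R) (Y : kind).
Variables (A : zmodType) (y : S -> A).
Hypothesis yR : forall u, R u -> colour_sum y [:: lhs u] = colour_sum y [:: rhs u].

Definition FS_sum l r (f : FS R l r) : A := colour_sum y (repr f).

Lemma FS_sumE l r (F : forest S l r) : FS_sum (\pi_(FS R l r) F) = colour_sum y F.
Proof. exact/(colour_sum_skein yR)/skein_repr. Qed.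

Lemma FSY_sum_comp l m r (p : FSY R Y m r) (q : FSY R Y l m) :
  FS_sum (FSY_comp p q).1 = FS_sum p.1 + FS_sum q.1.
Proof.
case: p q => f s [g t] /=; elim/FS_ind: f => F; elim/FS_ind: g => H.
rewrite FS_permE FS_compE !FS_sumE colour_sum_comp.
  by rewrite colour_sum_permseq // size_forest.
by rewrite size_permseq fleaves_forest.
Qed.

Lemma FSgroup_char : exists h : FSgroup oreR Y -> A,
  {morph h : g k / (g * k)%g >-> g + k} /\
  forall l (p q : FSY R Y l 1), h (FSfrac oreR p q) = FS_sum p.1 - FS_sum q.1.
Proof.
pose h (g : FSgroup oreR Y) : A :=
  let: existT l (p, q) := repr g in FS_sum p.1 - FS_sum q.1.
have hE l (p q : FSY R Y l 1) : h (FSfrac oreR p q) = FS_sum p.1 - FS_sum q.1.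
  rewrite /h; have : FSfrac oreR p q = \pi_(FSgroup oreR Y) (repr (FSfrac oreR p q)).
    by rewrite reprK.
  (* Equal fractions have a common expansion, by [u] and by [v]; expanding adds the same sum to both
     entries. *)
  case: (repr _) => m [p' q'] /FSfracP[k [u [v [E1 E2]]]].
  have := congr1 (fun z => FS_sum z.1) E1; have := congr1 (fun z => FS_sum z.1) E2.
  rewrite !FSY_sum_comp => Eq Ep.
  apply/eqP; rewrite subr_eq addrAC eq_sym subr_eq; apply/eqP.
  apply: (addIr (FS_sum u.1 + FS_sum v.1)).
  by rewrite addrACA Ep /= -Eq /= [in RHS](addrC (FS_sum u.1)) addrACA.
exists h; split=> // g k; have [l [p [q [r [-> ->]]]]] := FSfrac_common g k.
have -> : (FSfrac oreR p q * FSfrac oreR q r)%g = FSfrac oreR p r by exact: FSgroup_mulE.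
by rewrite !hE addrA subrK.
Qed.

End GroupCharacter.

Section Lift.
Variables (S : choiceType) (A : zmodType) (y : S -> A).

Lemma freeg_lift : exists h : {additive {freeg S / int} -> A}, forall c, h << c >> = y c.
Proof.
pose h : {freeg S / int} -> A := fglift (y : S -> zmodule A).
have hB : zmod_morphism h by exact: (@lift_is_additive _ _ (zmodule A : lmodType int) y).
pose hm := GRing.isZmodMorphism.Build _ _ h hB.
exists (HB.pack_for {additive {freeg S / int} -> A} h hm) => c /=.
by rewrite /h liftU /= scale1r.
Qed.

Lemma zspan_ker (V : zmodType) (X : set V) (h : {additive V -> A}) v :
  (forall v, X v -> h v = 0) -> v \in zspan X -> h v = 0.
Proof.
move=> hX /asboolP; elim=> {v} [v /hX|| u v _ hu _ hv] //; first exact: raddf0.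
by rewrite raddfB hu hv subr0.
Qed.

End Lift.

(** * The isomorphism and its inverse *)

Section Isomorphism.
Variables (S : choiceType) (R : set (skein S)) (oreR : Ore R) (a : S) (Y : kind).
Notation Q := (colour_quotient R a).
Notation G := (FSgroup oreR Y).

Lemma morph_chi (A : zmodType) (h : {additive {freeg S / int} -> A}) t :
  h (chi t) = colour_sum (fun c => h << c >>) [:: t].
Proof. by rewrite raddf_sum /colour_sum fcolours1. Qed.

Lemma pi_eq0 v : v \in zspan (relators R a) -> \pi_Q v = 0.
Proof.
by move=> Xv; rewrite -(raddf0 (\pi_Q)); apply/eqP; rewrite -Quotient.idealrBE subr0.
Qed.

Lemma FSab_iso : exists phi : {additive abelianisation G -> Q},
  bijective phi /\
  forall l (t s : tree S) (tl : nleaves t = l) (sl : nleaves s = l)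
         (p : 'S_l) (Yp : p \in Sigma Y l),
    phi (to_ab (FSfrac oreR (FS_tree R tl, Subg Yp) (FS_tree R sl, 1%g))) =
    \pi_Q (chi t - chi s).
Proof.
pose y c : Q := \pi_Q << c >>.
have yE t : colour_sum y [:: t] = \pi_Q (chi t) by rewrite morph_chi.
have piB t s : \pi_Q (chi t - chi s) = colour_sum y [:: t] - colour_sum y [:: s].
  by rewrite !yE; exact: raddfB.
have yR u : R u -> colour_sum y [:: lhs u] = colour_sum y [:: rhs u].
  move=> Ru; apply/eqP; rewrite -subr_eq0 -piB.
  by apply/eqP/pi_eq0/asboolP/zspanned_gen; right; exists u.
have [h [hM hE]] := FSgroup_char oreR Y yR.
have [phi phiE] := ab_lift hM.
have phiP l (t s : tree S) (tl : nleaves t = l) (sl : nleaves s = l)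
    (p : 'S_l) (Yp : p \in Sigma Y l) :
    phi (to_ab (FSfrac oreR (FS_tree R tl, Subg Yp) (FS_tree R sl, 1%g))) =
    \pi_Q (chi t - chi s).
  by rewrite phiE hE /= !(FS_sumE yR) /= -piB.
exists phi; split=> //; pose w := caret_char oreR Y a.
have wa : w a = 0 := weight_vine (forest_char_vine oreR Y a).
have [k kE] := freeg_lift w.
have kchi u : k (chi u) = colour_sum w [:: u].
  by rewrite morph_chi; congr (\sum_(c <- _) _); apply/funext => c; rewrite kE.
have fracE l (t s : tree S) (tl : nleaves t = l) (sl : nleaves s = l)
    (p : 'S_l) (Yp : p \in Sigma Y l) :
    to_ab (FSfrac oreR (FS_tree R tl, Subg Yp) (FS_tree R sl, 1%g)) = k (chi t - chi s).
  by rewrite (to_ab_frac_pure a) /= !FSY_char_pure /= -!kchi -raddfB.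
apply: inj_surj_bijective => [|q].
  (* Injectivity: if [chi t - chi s] lies in the span of the relators, [k] kills it, so by [fracE]
     the class is 0. *)
  apply: raddf_inj; elim/ab_ind => g.
  have [l [t [s [tl [sl [p [Yp ->]]]]]]] := FSfrac_tree_perm g.
  rewrite phiP fracE => /eqP; rewrite -(raddf0 (\pi_Q)) -Quotient.idealrBE subr0.
  apply: zspan_ker => v [->|[u Ru ->]]; first by rewrite kE.
  apply/eqP; rewrite raddfB !kchi subr_eq0 -!forest_char_colour_sum //.
  exact/eqP/forest_char_skein/skein_base.
have phik c : phi (k << c >>) = y c.
  have ya : y a = 0 by apply/pi_eq0/asboolP/zspanned_gen; left.
  have csE (B : zmodType) (z : S -> B) e :
      colour_sum z [:: Node a Leaf (caret e)] = z a + z e.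
    by rewrite /colour_sum /fcolours /= !big_cons big_nil addr0.
  (* The trees have three leaves each and differ in one colour, [c] against [a]; both [w] and [y]
     vanish at [a]. *)
  have := phiP _ (Node a Leaf (caret c)) (Node a Leaf (caret a)) erefl erefl _ (group1 _).
  by rewrite fracE raddfB !kchi piB !csE wa ya !add0r !subr0 kE.
(* Surjectivity: [phi] after [k] agrees with the projection on basis elements, hence on any lift of
   [q]. *)
exists (k (repr q)); rewrite -[RHS]reprK; elim/quotW: q => v; move: (repr _) => {}v.
rewrite -[v]freeg_sumE !raddf_sum; apply: eq_bigr => c _.
have -> : << coeff c v *g c >> = << c >> *~ coeff c v by rewrite freegU_mulz intz.
by rewrite !raddfMz /= phik.
Qed.

End Isomorphism.

Lemma zmod_isomorphic_sym (U V : zmodType) : zmod_isomorphic U V -> zmod_isomorphic V U.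
Proof.
move=> [f [g fK gK]].
have gB : zmod_morphism g by move=> u v; apply: (can_inj fK); rewrite raddfB !gK.
pose gm := GRing.isZmodMorphism.Build _ _ g gB.
by exists (HB.pack_for {additive V -> U} g gm); exists f.
Qed.

Lemma zmod_isomorphic_trans (U V W : zmodType) :
  zmod_isomorphic U V -> zmod_isomorphic V W -> zmod_isomorphic U W.
Proof. by move=> [f bf] [g bg]; exists (g \o f); apply: bij_comp. Qed.

Theorem theorem5 (S : choiceType) (R : set (skein S)) (oreR : Ore R) (a : S) :
  (forall Y : kind,
     exists phi : {additive abelianisation (FSgroup oreR Y) -> colour_quotient R a},
       bijective phi /\
       forall (l : nat) (t s : tree S) (tl : nleaves t = l) (sl : nleaves s = l)
              (p : 'S_l) (Yp : p \in Sigma Y l),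
         phi (to_ab (FSfrac oreR (FS_tree R tl, Subg Yp) (FS_tree R sl, 1%g))) =
         \pi_(colour_quotient R a) (chi t - chi s)) /\
  zmod_isomorphic (abelianisation (FSgroup oreR KindT))
                  (abelianisation (FSgroup oreR KindV)) /\
  zmod_isomorphic (abelianisation (FSgroup oreR KindV)) (colour_quotient R a).
Proof.
have iso Y : zmod_isomorphic (abelianisation (FSgroup oreR Y)) (colour_quotient R a).
  by have [phi [phi_bij _]] := FSab_iso oreR a Y; exists phi.
split=> [Y|]; first exact: FSab_iso.
split=> //; exact: zmod_isomorphic_trans (iso _) (zmod_isomorphic_sym (iso _)).
Qed.
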